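(* Let $\{X^k\}_{k\ge 0}\subset \mathbb{R}^{n\times n}\times\mathcal{O}(n)\times\mathcal{V}$ be a sequence generated by the Riemannian inexact Newton-CG method (described in the context), and let $\overline{X}\in \mathbb{R}^{n\times n}\times\mathcal{O}(n)\times\mathcal{V}$ be an accumulation point of $\{X^k\}$. Suppose that the linear operator $\mathrm{D}G(\overline{X}):T_{\overline{X}}(\mathbb{R}^{n\times n}\times\mathcal{O}(n)\times\mathcal{V})\to T_{G(\overline X)}\mathbb{R}^{n\times n}\simeq\mathbb{R}^{n\times n}$ is surjective. Then the whole sequence $\{X^k\}$ converges to $\overline{X}$ quadratically.
   Context: **The equation.** Let $\{\lambda_1,\dots,\lambda_n\}$ be a self-conjugate set (list) of complex numbers, ordered so that $\lambda_{2i-1}=a_i+b_i\sqrt{-1}$, $\lambda_{2i}=a_i-b_i\sqrt{-1}$ with $a_i,b_i\in\mathbb{R}$, $b_i\ne 0$ for $i=1,\dots,s$, and $\lambda_i\in\mathbb{R}$ for $i=2s+1,\dots,n$. Let $\Lambda\in\mathbb{R}^{n\times n}$ be the block diagonal matrix $\Lambda=\mathrm{blkdiag}(\lambda_1^{[2]},\dots,\lambda_s^{[2]},\lambda_{2s+1},\dots,\lambda_n)$ with $\lambda_i^{[2]}=\begin{bmatrix}a_i&b_i\\-b_i&a_i\end{bmatrix}$. Let $\mathcal{O}(n)=\{Q\in\mathbb{R}^{n\times n}: Q^TQ=I_n\}$, $\mathcal{I}=\{(i,j): 1\le i,j\le n,\ i\ge j \text{ or } \Lambda_{ij}\neq 0\}$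 and $\mathcal{V}=\{V\in\mathbb{R}^{n\times n}: V_{ij}=0 \text{ for } (i,j)\in\mathcal{I}\}$. With $\odot$ the Hadamard (entrywise) product, define the smooth map $$G:\mathbb{R}^{n\times n}\times\mathcal{O}(n)\times\mathcal{V}\to\mathbb{R}^{n\times n},\qquad G(S,Q,V)=S\odot S-Q(\Lambda+V)Q^T .$$ **Geometry.** The product manifold $\mathbb{R}^{n\times n}\times\mathcal{O}(n)\times\mathcal{V}$ has tangent space $\mathbb{R}^{n\times n}\times\{Q\Omega:\Omega\in\mathbb{R}^{n\times n},\Omega^T=-\Omega\}\times\mathcal{V}$ at $(S,Q,V)$, and carries the Riemannian metric $\langle(\xi_1,\zeta_1,\eta_1),(\xi_2,\zeta_2,\eta_2)\rangle=\mathrm{tr}(\xi_1^T\xi_2)+\mathrm{tr}(\zeta_1^T\zeta_2)+\mathrm{tr}(\eta_1^T\eta_2)$, with induced norm $\|\cdot\|$; $\mathrm{dist}$ denotes the Riemannian distance. $\mathbb{R}^{n\times n}$ (the target of $G$, whose tangent spaces are identified with $\mathbb{R}^{n\times n}$) carries the Frobenius inner product and norm $\|\cdot\|_F$. $\mathrm{D}G(X)$ is the differential of $G$ at $X$, $(\mathrm{D}G(X))^*$ its adjoint with respect to these inner products, and $\mathrm{id}$ the identity operator on $\mathbb{R}^{n\times n}$. The retraction $R$ is $R_{(S,Q,V)}(\xi,\zeta,\eta)=(S+\xi,\ \mathrm{qf}(Q+\zeta),\ V+\eta)$, where $\mathrm{qf}(A)$ is the orthogonal factor in the QR decomposition $A=Q\widetilde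 R$ of a nonsingular $A$ with $\widetilde R$ upper triangular with strictly positive diagonal. **Quadratic convergence.** $\{X^k\}$ converges to $\overline X$ quadratically if $X^k\to\overline X$ and there is a constant $c>0$ such that $\mathrm{dist}(X^{k+1},\overline X)\le c\,(\mathrm{dist}(X^k,\overline X))^2$ for all $k$ sufficiently large. **Riemannian inexact Newton-CG method.** Step 0: choose $X^0\in\mathbb{R}^{n\times n}\times\mathcal{O}(n)\times\mathcal{V}$, $\overline\sigma_{\max},\overline\eta_{\max},\widehat\eta_{\max}\in[0,1)$, $t\in(0,1)$, $0<\theta_{\min}<\theta_{\max}<1$; set $k=0$. Step 1: with $\overline\sigma_k=\min\{\overline\sigma_{\max},\|G(X^k)\|_F\}$ and $\overline\eta_k=\min\{\overline\eta_{\max},\|G(X^k)\|_F\}$, apply the conjugate gradient (CG) method to $(\mathrm{D}G(X^k)\circ(\mathrm{D}G(X^k))^*+\overline\sigma_k\,\mathrm{id})[\Delta Z^k]=-G(X^k)$ to find $\Delta Z^k\in\mathbb{R}^{n\times n}$ such that (a) $\|(\mathrm{D}G(X^k)\circ(\mathrm{D}G(X^k))^*+\overline\sigma_k\,\mathrm{id})[\Delta Z^k]+G(X^k)\|_F\le\overline\eta_k\|G(X^k)\|_F$, and (b) $\|\mathrm{D}G(X^k)\circ(\mathrm{D}G(X^k))^*[\Delta Z^k]+G(X^k)\|_F\le\widehat\eta_{\max}\|G(X^k)\|_F$. Set $\widehat{\Delta X}^k=(\mathrm{D}G(X^k))^*[\Delta Z^k]$ and $\widehat\eta_k=\|\mathrm{D}G(X^k)[\widehat{\Delta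 X}^k]+G(X^k)\|_F/\|G(X^k)\|_F$. Step 2: set $\eta_k=\widehat\eta_k$, $\Delta X^k=\widehat{\Delta X}^k$. Repeat-loop: until $\|G(R_{X^k}(\Delta X^k))\|_F\le(1-t(1-\eta_k))\|G(X^k)\|_F$ holds, choose $\theta\in[\theta_{\min},\theta_{\max}]$ (possibly different each time) and replace $\Delta X^k$ by $\theta\Delta X^k$ and $\eta_k$ by $1-\theta(1-\eta_k)$. Then set $X^{k+1}=R_{X^k}(\Delta X^k)$. Step 3: replace $k$ by $k+1$ and go to Step 1. A sequence $\{X^k\}$ is generated by the method if for every $k\ge0$ Step 1 produces such a $\Delta Z^k$, the repeat-loop terminates, and $X^{k+1}=R_{X^k}(\Delta X^k)$ with $\Delta X^k$ the final value at termination of the repeat-loop; in particular $G(X^k)\ne\mathbf{0}_{n\times n}$ for all $k$, so that $\widehat\eta_k$ is defined. *)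

(* Defs.v *)
From mathcomp Require Import all_boot all_order all_algebra.
From mathcomp Require Import all_classical all_reals all_analysis.
From mathcomp Require Import complex.

Set Implicit Arguments.
Unset Strict Implicit.
Unset Printing Implicit Defensive.

Import Order.TTheory GRing.Theory Num.Theory.
Import numFieldNormedType.Exports.

Local Open Scope classical_set_scope.
Local Open Scope ring_scope.

Definition frob (R : realType) (n : nat) (A B : 'M[R]_n) : R := \tr (A^T *m B).

Definition fnorm (R : realType) (n : nat) (A : 'M[R]_n) : R :=
  Num.sqrt (frob A A).

Definition hadamard (R : realType) (n : nat) (A B : 'M[R]_n) : 'M[R]_n :=
  map2_mx *%R A B.

(* Entries are numbered from 0, so the s conjugate pairs occupy the positions
   (0, 1), (2, 3), ..., (2s - 2, 2s - 1). *)
Definition pairs_first (R : realType) (n s : nat) (lam : n.-tuple R[i]) : Prop :=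
  [/\ (s.*2 <= n)%N,
      forall i j : 'I_n, (i < s.*2)%N -> ~~ odd i -> j = i.+1 :> nat ->
        complex.Im (tnth lam i) != 0 /\ tnth lam j = conjc (tnth lam i)
    & forall i : 'I_n, (s.*2 <= i)%N -> complex.Im (tnth lam i) = 0].

Definition self_conjugate (R : realType) (n : nat) (lam : n.-tuple R[i]) : Prop :=
  perm_eq [seq conjc z | z <- lam] lam.

Definition Lambda (R : realType) (n s : nat) (lam : n.-tuple R[i]) : 'M[R]_n :=
  \matrix_(i, j)
    if i == j then complex.Re (tnth lam i)
    else if [&& j == i.+1 :> nat, ~~ odd i & (j < s.*2)%N]
    then complex.Im (tnth lam i)
    else if [&& i == j.+1 :> nat, ~~ odd j & (i < s.*2)%N]
    then - complex.Im (tnth lam j)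
    else 0.

Definition orthogonal_mx (R : realType) (n : nat) (Q : 'M[R]_n) : Prop :=
  Q^T *m Q = 1%:M.

(* The space V attached to L = Lambda: the index set on which V vanishes is
   {(i, j) | i >= j or L i j <> 0}. *)
Definition Vspace (R : realType) (n : nat) (L : 'M[R]_n) : set 'M[R]_n :=
  [set V | forall i j : 'I_n, (j <= i)%N || (L i j != 0) -> V i j = 0].

(* The product manifold is embedded in the vector space [ambient] of triples
   (S, Q, V). *)
Definition ambient (R : realType) (n : nat) : normedModType R :=
  ('M[R]_n * 'M[R]_n * 'M[R]_n)%type.

Definition manifold (R : realType) (n : nat) (L : 'M[R]_n) :
    set (ambient R n) :=
  [set X | orthogonal_mx X.1.2 /\ Vspace L X.2].

Definition tangent (R : realType) (n : nat) (L : 'M[R]_n) (X : ambient R n) :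
    set (ambient R n) :=
  [set xi | (exists2 Omega : 'M[R]_n, Omega^T = - Omega
                                    & xi.1.2 = X.1.2 *m Omega)
            /\ Vspace L xi.2].

Definition metric (R : realType) (n : nat) (xi zeta : ambient R n) : R :=
  frob xi.1.1 zeta.1.1 + frob xi.1.2 zeta.1.2 + frob xi.2 zeta.2.

Definition mnorm (R : realType) (n : nat) (xi : ambient R n) : R :=
  Num.sqrt (metric xi xi).

Definition C1_on (R : realType) (n : nat) (a b : R) (g : R -> ambient R n) :
    Prop :=
  exists dg : R -> ambient R n,
    [/\ {within `[a, b], continuous g}, {within `[a, b], continuous dg}
      & forall t : R, a < t < b -> is_derive t (1 : R) g (dg t)].

Definition piecewise_C1 (R : realType) (n : nat) (g : R -> ambient R n) : Prop :=
  exists2 s : seq R, itv_partition 0 1 s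
    & forall i : nat, (i < size s)%N ->
        C1_on (nth 0 (0 :: s) i) (nth 0 s i) g.

(* The derivative is undefined at the finitely many break points, which form a
   null set. *)
Definition curve_length (R : realType) (n : nat) (g : R -> ambient R n) :
    \bar R :=
  (\int[@lebesgue_measure R]_(t in `[0%R, 1%R]) (mnorm (g^`()%classic t))%:E)%E.

(* Points that no curve joins (the two components of O(n)) are at distance
   +oo. *)
Definition rdist (R : realType) (n : nat) (L : 'M[R]_n) (X Y : ambient R n) :
    \bar R :=
  ereal_inf [set curve_length g | g in
    [set g : R -> ambient R n |
      [/\ piecewise_C1 g, forall t : R, 0 <= t <= 1 -> manifold L (g t),
          g 0 = X & g 1 = Y]]].

(* G is given by a polynomial formula on the whole of [ambient]; its
   differential as a map on the manifold is the restriction to [tangent] of the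
   differential of this extension. *)
Definition G (R : realType) (n : nat) (L : 'M[R]_n) (X : ambient R n) :
    'M[R]_n :=
  hadamard X.1.1 X.1.1 - X.1.2 *m (L + X.2) *m X.1.2^T.

Definition DG (R : realType) (n : nat) (L : 'M[R]_n) (X xi : ambient R n) :
    'M[R]_n :=
  'd (G L) X xi.

Definition DGadj (R : realType) (n : nat) (L : 'M[R]_n) (X : ambient R n)
    (Z : 'M[R]_n) : ambient R n :=
  xget 0 [set W : ambient R n | tangent L X W /\
    forall xi : ambient R n, tangent L X xi ->
      frob (DG L X xi) Z = metric xi W].

Definition qf (R : realType) (n : nat) (A : 'M[R]_n) : 'M[R]_n :=
  xget 0 [set Q : 'M[R]_n | orthogonal_mx Q /\
    exists T : 'M[R]_n,
      [/\ forall i j : 'I_n, (j < i)%N -> T i j = 0,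
          forall i : 'I_n, 0 < T i i & A = Q *m T]].

Definition retraction (R : realType) (n : nat) (X xi : ambient R n) :
    ambient R n :=
  (X.1.1 + xi.1.1, qf (X.1.2 + xi.1.2), X.2 + xi.2).

(* [cg_iterate A b z0 z r p]: the conjugate gradient method for A z = b started
   at z0 reaches the iterate z, with residual r and search direction p. It
   stops when <p, A p> = 0, in particular as soon as the residual vanishes. *)
Inductive cg_iterate (R : realType) (n : nat) (A : 'M[R]_n -> 'M[R]_n)
    (b z0 : 'M[R]_n) : 'M[R]_n -> 'M[R]_n -> 'M[R]_n -> Prop :=
| cg_start : cg_iterate A b z0 z0 (b - A z0) (b - A z0)
| cg_step (z r p : 'M[R]_n) :
    cg_iterate A b z0 z r p -> frob p (A p) != 0 ->
    let alpha := frob r r / frob p (A p) in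
    let r' := r - alpha *: A p in
    let beta := frob r' r' / frob r r in
    cg_iterate A b z0 (z + alpha *: p) r' (r' + beta *: p).

(* The line search leads from (dX, eta) to the pair (dX', eta') at which it
   terminates; the factor theta may differ from one round to the next. *)
Inductive backtrack (R : realType) (n : nat) (L : 'M[R]_n)
    (t theta_min theta_max : R) (X : ambient R n) :
    ambient R n -> R -> ambient R n -> R -> Prop :=
| backtrack_stop (dX : ambient R n) (eta : R) :
    fnorm (G L (retraction X dX)) <= (1 - t * (1 - eta)) * fnorm (G L X) ->
    backtrack L t theta_min theta_max X dX eta dX eta
| backtrack_shrink (dX : ambient R n) (eta theta : R)
    (dX' : ambient R n) (eta' : R) :
    ~ fnorm (G L (retraction X dX)) <= (1 - t * (1 - eta)) * fnorm (G L X) ->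
    theta_min <= theta <= theta_max ->
    backtrack L t theta_min theta_max X
      (theta *: dX) (1 - theta * (1 - eta)) dX' eta' ->
    backtrack L t theta_min theta_max X dX eta dX' eta'.

Definition newton_cg_step (R : realType) (n : nat) (L : 'M[R]_n)
    (sigma_max eta_max etahat_max t theta_min theta_max : R)
    (X Xnext : ambient R n) : Prop :=
  let g := fnorm (G L X) in
  let sigma := Num.min sigma_max g in
  let eta := Num.min eta_max g in
  let H := fun Z : 'M[R]_n => DG L X (DGadj L X Z) in
  let A := fun Z : 'M[R]_n => H Z + sigma *: Z in
  G L X != 0 /\
  exists dZ : 'M[R]_n,
    [/\ exists z0 r p : 'M[R]_n, cg_iterate A (- G L X) z0 dZ r p,
        fnorm (A dZ + G L X) <= eta * g,
        fnorm (H dZ + G L X) <= etahat_max * g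
      & let dXhat := DGadj L X dZ in
        let etahat := fnorm (DG L X dXhat + G L X) / g in
        exists (dX : ambient R n) (eta' : R),
          backtrack L t theta_min theta_max X dXhat etahat dX eta'
          /\ Xnext = retraction X dX].

Definition generated_by_newton_cg (R : realType) (n : nat) (L : 'M[R]_n)
    (sigma_max eta_max etahat_max t theta_min theta_max : R)
    (X : nat -> ambient R n) : Prop :=
  manifold L (X 0%N) /\
  forall k : nat,
    newton_cg_step L sigma_max eta_max etahat_max t theta_min theta_max
      (X k) (X k.+1).

Definition converges_quadratically (R : realType) (n : nat) (L : 'M[R]_n)
    (X : nat -> ambient R n) (Xbar : ambient R n) : Prop :=
  X k @[k --> \oo] --> Xbar /\
  exists2 c : R, 0 < c &
    \forall k \near \oo,
      (rdist L (X k.+1) Xbar <= c%:E * rdist L (X k) Xbar ^+ 2)%E.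

(* Main.v *)
(* Near [Xbar] surjectivity of [DG] gives [|Z| <= kappa |DG^* Z|], hence CG
   steps of size [O(|G X|)] with linear residual [O(|G X|^2)]. The retraction
   agrees with addition to second order, so the line search accepts a step
   fraction bounded below: as [Xbar] is an accumulation point, [|G (X k)|] tends
   to 0. Close to [Xbar] full steps are accepted and [|G (X k)|] decreases
   quadratically; summing the step lengths traps the sequence and bounds
   [|X k - Xbar|] by a multiple of [|G (X k)|], while [|G (X k)|] is at most a
   multiple of [|X k - Xbar|]. Finally the Riemannian distance and the ambient
   norm are comparable: a curve is at least as long as its chord, and nearby
   points of O(n) are joined by a Cayley curve of comparable length. *)
From HB Require Import structures.
Require Import Defs.
From mathcomp Require Import all_boot all_order all_algebra.
From mathcomp Require Import all_classical all_reals all_analysis.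
From mathcomp Require Import complex.
From mathcomp Require Import ring lra measurable_realfun.

Set Implicit Arguments.
Unset Strict Implicit.
Unset Printing Implicit Defensive.

Import Order.TTheory GRing.Theory Num.Theory.
Import numFieldNormedType.Exports.

Local Open Scope classical_set_scope.
Local Open Scope ring_scope.

(** * Frobenius norm and product norm *)


(** Two norms coexist. Limits and differentials use the library norm of [ambient], a maximum over
    entries, whereas the estimates are made for the Euclidean [mnorm]; the two differ by a factor of
    at most [3 * n]. Tangent spaces change with the point. So [dG] is a formula on all of [ambient],
    and a tangent vector at [Xbar] is moved to [X] by keeping its skew generator [W] and replacing
    [Qbar W] by [Q W], which preserves its norm. Skewness of [W] also makes [(1 - W)^-1] a
    contraction whatever the size of [W]. This one fact yields the second-order bound for [qf] and
    the bounds on the Cayley curve, with explicit constants and without differentiating [qf]. In the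
    final inequality a distance may be [+oo]. This is harmless: an upper bound is wanted at
    [X k.+1], which is close to [Xbar], and at [X k] a lower bound, which holds everywhere. *)

Definition semi_inner (R : realType) (V : lmodType R) (B : V -> V -> R) : Prop :=
  [/\ forall x y, B x y = B y x,
      forall a x y z, B (a *: x + y) z = a * B x z + B y z
    & forall x, 0 <= B x x].

(** One proof serves [frob], [metric] and the dot product in [sum_CS]. The quadratic
    [a |-> B (a x + y) (a x + y)] is nonnegative, and its value at the minimiser [- B x y / B x x]
    gives the inequality. *)
Lemma semi_inner_CS (R : realType) (V : lmodType R) (B : V -> V -> R) (x y : V) :
  semi_inner B -> `|B x y| <= Num.sqrt (B x x) * Num.sqrt (B y y).
Proof.
move=> [sB lB pB].
have lin a : B (a *: x + y) (a *: x + y) = a ^+ 2 * B x x + 2 * a * B x y + B y y.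
  by rewrite lB !(sB _ (a *: x + y)) !lB (sB y x); ring.
rewrite -sqrtrM ?pB// -sqrtr_sqr ler_wsqrtr //.
have [x0|x0] := eqVneq (B x x) 0; last first.
  have xp : 0 < B x x by rewrite lt_neqAle eq_sym x0 pB.
  have := pB (- B x y / B x x *: x + y); rewrite lin => h.
  have e : (- B x y / B x x) ^+ 2 * B x x + 2 * (- B x y / B x x) * B x y + B y y
           = B y y - B x y ^+ 2 / B x x by field.
  rewrite e subr_ge0 ler_pdivrMr // in h.
  by rewrite mulrC.
rewrite x0 mul0r; have [->|xy0] := eqVneq (B x y) 0; first by rewrite expr0n.
(* When [B x x = 0] the expression is affine in [a], so a nonzero slope would let it take the value
   [-1]. *)
have := pB (- (B y y + 1) / (2 * B x y) *: x + y); rewrite lin x0.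
have -> : (- (B y y + 1) / (2 * B x y)) ^+ 2 * 0 +
  2 * (- (B y y + 1) / (2 * B x y)) * B x y + B y y = - 1 by field.
by lra.
Qed.

Lemma semi_inner_triangle (R : realType) (V : lmodType R) (B : V -> V -> R) (x y : V) :
  semi_inner B ->
  Num.sqrt (B (x + y) (x + y)) <= Num.sqrt (B x x) + Num.sqrt (B y y).
Proof.
move=> hB; have := semi_inner_CS x y hB; case: hB => [sB lB pB] cs.
have add u v w : B (u + v) w = B u w + B v w.
  by rewrite -{1}[u]scale1r lB mul1r.
have -> : B (x + y) (x + y) = B x x + 2 * B x y + B y y.
  by rewrite add !(sB _ (x + y)) !add (sB y x); ring.
have s0 := sqrtr_ge0 (B x x); have s1 := sqrtr_ge0 (B y y).
rewrite -[leRHS]ger0_norm ?addr_ge0 // -sqrtr_sqr ler_wsqrtr //.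
rewrite sqrrD !sqr_sqrtr ?pB//.
have := ler_norm (B x y); lra.
Qed.

Lemma semi_inner_scale (R : realType) (V : lmodType R) (B : V -> V -> R) a (x : V) :
  semi_inner B -> Num.sqrt (B (a *: x) (a *: x)) = `|a| * Num.sqrt (B x x).
Proof.
move=> [sB lB pB].
have lin u w : B (a *: u) w = a * B u w.
  have B0 v : B 0 v = 0.
    by have := lB 1 0 0 v; rewrite scaler0 addr0 mul1r => h; lra.
  by rewrite -[a *: u]addr0 lB B0 addr0.
by rewrite lin sB lin mulrA -expr2 sqrtrM ?sqr_ge0 // sqrtr_sqr.
Qed.

Section Frobenius.
Variables (R : realType) (n : nat).
Implicit Types A B : 'M[R]_n.

Lemma frobE A B : frob A B = \sum_i \sum_j A i j * B i j.
Proof.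
rewrite /frob /mxtrace exchange_big; apply: eq_bigr => j _.
by rewrite mxE; apply: eq_bigr => i _; rewrite mxE.
Qed.

Lemma frob_semi_inner : semi_inner (@frob R n).
Proof.
split=> [A B|a A B C|A]; rewrite !frobE.
- by apply: eq_bigr => i _; apply: eq_bigr => j _; rewrite mulrC.
- rewrite mulr_sumr -big_split; apply: eq_bigr => i _ /=.
  rewrite mulr_sumr -big_split; apply: eq_bigr => j _ /=.
  by rewrite !mxE; ring.
- by apply: sumr_ge0 => i _; apply: sumr_ge0 => j _; rewrite -expr2 sqr_ge0.
Qed.

Lemma frobC A B : frob A B = frob B A.
Proof. by case: frob_semi_inner. Qed.

Lemma frobDl A B C : frob (A + B) C = frob A C + frob B C.
Proof. by rewrite /frob linearD mulmxDl linearD. Qed.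

Lemma frobDr A B C : frob A (B + C) = frob A B + frob A C.
Proof. by rewrite /frob mulmxDr linearD. Qed.

Lemma frobNl A C : frob (- A) C = - frob A C.
Proof. by rewrite /frob linearN mulNmx linearN. Qed.

Lemma frobNr A C : frob A (- C) = - frob A C.
Proof. by rewrite /frob mulmxN linearN. Qed.

Lemma frobZl a A C : frob (a *: A) C = a * frob A C.
Proof. by rewrite /frob linearZ -scalemxAl linearZ. Qed.

Lemma frobZr a A C : frob A (a *: C) = a * frob A C.
Proof. by rewrite /frob -scalemxAr linearZ. Qed.

Lemma frob_ge0 A : 0 <= frob A A.
Proof. by case: frob_semi_inner. Qed.

Lemma fnorm_ge0 A : 0 <= fnorm A.
Proof. exact: sqrtr_ge0. Qed.

Lemma fnorm_sqr A : fnorm A ^+ 2 = frob A A.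
Proof. by rewrite sqr_sqrtr // frob_ge0. Qed.

Lemma fnorm_le A c : 0 <= c -> frob A A <= c ^+ 2 -> fnorm A <= c.
Proof.
by move=> c0 h; rewrite -[leRHS]ger0_norm // -sqrtr_sqr ler_wsqrtr.
Qed.

Lemma ler_frob_fnorm A B : `|frob A B| <= fnorm A * fnorm B.
Proof. exact: semi_inner_CS frob_semi_inner. Qed.

Lemma fnormD A B : fnorm (A + B) <= fnorm A + fnorm B.
Proof. exact: semi_inner_triangle frob_semi_inner. Qed.

Lemma fnormZ a A : fnorm (a *: A) = `|a| * fnorm A.
Proof. exact: semi_inner_scale frob_semi_inner. Qed.

Lemma fnormN A : fnorm (- A) = fnorm A.
Proof. by rewrite -scaleN1r fnormZ normrN1 mul1r. Qed.

Lemma fnormB A B : fnorm (A - B) <= fnorm A + fnorm B.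
Proof. by rewrite -(fnormN B) fnormD. Qed.

Lemma fnorm0 : fnorm (0 : 'M[R]_n) = 0.
Proof. by rewrite -(scale0r 0) fnormZ normr0 mul0r. Qed.

Lemma fnorm_entry A i j : `|A i j| <= fnorm A.
Proof.
rewrite -sqrtr_sqr ler_wsqrtr // frobE (bigD1 i) //= (bigD1 j) //= -expr2 -addrA.
rewrite lerDl addr_ge0 //; first by apply: sumr_ge0 => k _; rewrite -expr2 sqr_ge0.
by apply: sumr_ge0 => k _; apply: sumr_ge0 => l _; rewrite -expr2 sqr_ge0.
Qed.

Lemma fnorm_eq0 A : fnorm A = 0 -> A = 0.
Proof.
move=> h; apply/matrixP => i j; apply/eqP; rewrite mxE -normr_le0 -h.
exact: fnorm_entry.
Qed.

Lemma fnorm_gt0 A : A != 0 -> 0 < fnorm A.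
Proof.
move=> A0; rewrite lt_neqAle fnorm_ge0 andbT; apply: contra A0 => /eqP h.
by rewrite (fnorm_eq0 (esym h)).
Qed.

Lemma fnormT A : fnorm A^T = fnorm A.
Proof. by rewrite /fnorm /frob trmxK mxtrace_mulC. Qed.

Lemma sum_CS (F H : 'I_n -> R) :
  (\sum_k F k * H k) ^+ 2 <= (\sum_k F k ^+ 2) * (\sum_k H k ^+ 2).
Proof.
pose B (x y : 'rV[R]_n) := \sum_k x 0 k * y 0 k.
have hB : semi_inner B.
  split=> [x y|a x y z|x].
  - by apply: eq_bigr => k _; rewrite mulrC.
  - rewrite mulr_sumr -big_split; apply: eq_bigr => k _ /=.
    by rewrite !mxE; ring.
  - by apply: sumr_ge0 => k _; rewrite -expr2 sqr_ge0.
have [_ _ pB] := hB.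
have := semi_inner_CS (\row_k F k) (\row_k H k) hB.
have e (F1 F2 : 'I_n -> R) : B (\row_k F1 k) (\row_k F2 k) = \sum_k F1 k * F2 k.
  by apply: eq_bigr => k _; rewrite !mxE.
rewrite -[X in X <= _]normr_id => /(lerXn2r 2) h.
have {}h := h (normr_ge0 _) (mulr_ge0 (sqrtr_ge0 _) (sqrtr_ge0 _)).
rewrite normr_id real_normK ?num_real // exprMn !sqr_sqrtr ?pB // !e in h.
by move: h; under [X in _ <= X * _ -> _]eq_bigr do rewrite -expr2;
   under [X in _ <= _ * X -> _]eq_bigr do rewrite -expr2.
Qed.

Lemma fnormM A B : fnorm (A *m B) <= fnorm A * fnorm B.
Proof.
apply: fnorm_le; first by rewrite mulr_ge0 ?fnorm_ge0.
rewrite exprMn !fnorm_sqr !frobE [X in _ <= _ * X]exchange_big /= mulr_suml.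
apply: ler_sum => i _; rewrite mulr_sumr; apply: ler_sum => j _.
rewrite -expr2 mxE; apply: le_trans (sum_CS _ _) _.
by rewrite le_eqVlt; apply/orP; left; apply/eqP; congr (_ * _);
   apply: eq_bigr => k _; rewrite expr2.
Qed.

Lemma fnorm_hadamard A B : fnorm (hadamard A B) <= fnorm A * fnorm B.
Proof.
apply: fnorm_le; first by rewrite mulr_ge0 ?fnorm_ge0.
rewrite exprMn (fnorm_sqr A) !frobE mulr_suml.
apply: ler_sum => i _; rewrite mulr_suml; apply: ler_sum => j _.
rewrite mxE mulrACA -!expr2 ler_wpM2l ?sqr_ge0 //.
rewrite -[B i j ^+ 2]real_normK ?num_real // lerXn2r ?nnegrE ?fnorm_ge0 //.
exact: fnorm_entry.
Qed.

Lemma orthogonal_mxT (Q : 'M[R]_n) : orthogonal_mx Q -> Q *m Q^T = 1%:M.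
Proof. exact: mulmx1C. Qed.

Lemma fnorm_orthl Q A : orthogonal_mx Q -> fnorm (Q *m A) = fnorm A.
Proof.
by move=> hQ; rewrite /fnorm /frob trmx_mul mulmxA -(mulmxA _ Q^T) hQ mulmx1.
Qed.

Lemma orthogonal_trmx (Q : 'M[R]_n) : orthogonal_mx Q -> orthogonal_mx Q^T.
Proof. by move=> hQ; rewrite /orthogonal_mx trmxK orthogonal_mxT. Qed.

End Frobenius.

Section ProductNorm.
Variables (R : realType) (n : nat).
Implicit Types X Y : ambient R n.

Lemma metric_semi_inner : semi_inner (@metric R n).
Proof.
have [s l p] := frob_semi_inner R n.
split=> [X Y|a X Y Z|X]; rewrite /metric.
- by rewrite !(frobC X.1.1) !(frobC X.1.2) (frobC X.2).
- by rewrite !l; ring.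
- by rewrite !addr_ge0.
Qed.

Lemma metricDl X Y Z : metric (X + Y) Z = metric X Z + metric Y Z.
Proof. by case: metric_semi_inner => _ l _; rewrite -{1}[X]scale1r l mul1r. Qed.

Lemma metricZl a X Z : metric (a *: X) Z = a * metric X Z.
Proof. by rewrite /metric !frobZl; ring. Qed.

Lemma metricNl X Z : metric (- X) Z = - metric X Z.
Proof. by rewrite -scaleN1r metricZl mulN1r. Qed.

Lemma mnorm_ge0 X : 0 <= mnorm X.
Proof. exact: sqrtr_ge0. Qed.

Lemma mnorm_sqr X : mnorm X ^+ 2 = metric X X.
Proof. by rewrite sqr_sqrtr //; case: metric_semi_inner. Qed.

Lemma ler_metric_mnorm X Y : `|metric X Y| <= mnorm X * mnorm Y.
Proof. exact: semi_inner_CS metric_semi_inner. Qed.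

Lemma mnormD X Y : mnorm (X + Y) <= mnorm X + mnorm Y.
Proof. exact: semi_inner_triangle metric_semi_inner. Qed.

Lemma mnormZ a X : mnorm (a *: X) = `|a| * mnorm X.
Proof. exact: semi_inner_scale metric_semi_inner. Qed.

Lemma mnormN X : mnorm (- X) = mnorm X.
Proof. by rewrite -scaleN1r mnormZ normrN1 mul1r. Qed.

Lemma mnorm_distC X Y : mnorm (X - Y) = mnorm (Y - X).
Proof. by rewrite -mnormN opprB. Qed.

Lemma mnorm0 : mnorm (0 : ambient R n) = 0.
Proof. by rewrite -(scale0r 0) mnormZ normr0 mul0r. Qed.

Lemma mnorm_split X :
  mnorm X ^+ 2 = fnorm X.1.1 ^+ 2 + fnorm X.1.2 ^+ 2 + fnorm X.2 ^+ 2.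
Proof. by rewrite mnorm_sqr !fnorm_sqr. Qed.

Lemma fnorm_mnorm X :
  [/\ fnorm X.1.1 <= mnorm X, fnorm X.1.2 <= mnorm X & fnorm X.2 <= mnorm X].
Proof.
split; apply: fnorm_le; rewrite ?mnorm_ge0 // mnorm_sqr /metric.
- by rewrite -addrA lerDl addr_ge0 ?frob_ge0.
- by rewrite addrAC lerDr addr_ge0 ?frob_ge0.
- by rewrite lerDr addr_ge0 ?frob_ge0.
Qed.

Lemma mnorm_le_sum X : mnorm X <= fnorm X.1.1 + fnorm X.1.2 + fnorm X.2.
Proof.
have a0 := fnorm_ge0 X.1.1; have b0 := fnorm_ge0 X.1.2; have c0 := fnorm_ge0 X.2.
rewrite -[leRHS]ger0_norm ?addr_ge0 // -sqrtr_sqr ler_wsqrtr //.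
rewrite -mnorm_sqr mnorm_split.
have := mulr_ge0 a0 b0; have := mulr_ge0 a0 c0; have := mulr_ge0 b0 c0; nra.
Qed.

Lemma normr_fnorm (A : 'M[R]_n) : `|A| <= fnorm A.
Proof.
rewrite [in X in X <= _]/Num.norm /= mx_normrE bigmax_le ?fnorm_ge0 // => -[i j] _.
exact: fnorm_entry.
Qed.

Lemma normr_mnorm X : `|X| <= mnorm X.
Proof.
have [h1 h2 h3] := fnorm_mnorm X.
by rewrite prod_normE ge_max prod_normE ge_max; apply/andP; split;
   [apply/andP; split|]; apply: le_trans (normr_fnorm _) _.
Qed.

Lemma fnorm_normr (A : 'M[R]_n) : fnorm A <= n%:R * `|A|.
Proof.
apply: fnorm_le; first by rewrite mulr_ge0.
rewrite frobE exprMn.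
have -> : n%:R ^+ 2 * `|A| ^+ 2 = \sum_(i < n) \sum_(j < n) `|A| ^+ 2.
  by rewrite sumr_const card_ord sumr_const card_ord -mulr_natr -mulr_natr; ring.
apply: ler_sum => i _; apply: ler_sum => j _.
rewrite -expr2 -real_normK ?num_real // lerXn2r ?nnegrE //.
have -> : `|A| = mx_norm A by [].
by rewrite mx_normrE (le_bigmax _ (fun ij => `|A ij.1 ij.2|) (i, j)).
Qed.

Lemma mnorm_normr X : mnorm X <= 3 * n%:R * `|X|.
Proof.
apply: le_trans (mnorm_le_sum X) _.
have h (A : 'M[R]_n) : `|A| <= `|X| -> fnorm A <= n%:R * `|X|.
  by move=> hA; apply: le_trans (fnorm_normr A) _; rewrite ler_wpM2l.
have h1 : fnorm X.1.1 <= n%:R * `|X| by apply: h; rewrite !prod_normE !le_max lexx.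
have h2 : fnorm X.1.2 <= n%:R * `|X|.
  by apply: h; rewrite !prod_normE !le_max lexx orbT.
have h3 : fnorm X.2 <= n%:R * `|X| by apply: h; rewrite !prod_normE !le_max lexx orbT.
lra.
Qed.

End ProductNorm.

(** * Skew matrices and the QR factor *)


(** Injectivity is tested on square matrices because the bounds that supply it are stated for
    [fnorm]; the test matrix is the transposed kernel of [A^T]. *)
Lemma injective_unitmx (R : realType) (n : nat) (A : 'M[R]_n) :
  (forall Z : 'M[R]_n, A *m Z = 0 -> Z = 0) -> A \in unitmx.
Proof.
move=> inj; rewrite -unitmx_tr -row_free_unit -kermx_eq0.
apply/eqP/trmx_inj; rewrite trmx0; apply: inj.
by apply: trmx_inj; rewrite trmx_mul trmxK mulmx_ker trmx0.
Qed.

Section Skew.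
Variables (R : realType) (n : nat).
Implicit Types W Z : 'M[R]_n.

Lemma frob_skew W Z : W^T = - W -> frob Z (W *m Z) = 0.
Proof.
move=> hW; have : frob Z (W *m Z) = - frob Z (W *m Z).
  rewrite {1}/frob -mxtrace_tr !trmx_mul trmxK hW -mulmxA mulNmx mulmxN linearN.
  by rewrite /frob.
by lra.
Qed.

(** The cross terms vanish by skewness, so [|(1 - W) Z|^2 = |Z|^2 + |W Z|^2]. Hence [1 - W] is
    invertible and its inverse is a contraction, with no smallness condition on [W]. *)
Lemma fnorm_skew W Z : W^T = - W -> fnorm Z <= fnorm ((1%:M - W) *m Z).
Proof.
move=> hW; apply: fnorm_le; rewrite ?fnorm_ge0 // fnorm_sqr mulmxBl mul1mx.
rewrite frobDl !frobDr !frobNl !frobNr (frobC (W *m Z) Z) frob_skew //.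
by have := frob_ge0 (W *m Z); lra.
Qed.

Lemma skew_unitmx W : W^T = - W -> 1%:M - W \in unitmx.
Proof.
move=> hW; apply: injective_unitmx => Z h; apply: fnorm_eq0; apply/eqP.
by rewrite eq_le fnorm_ge0 andbT -(fnorm0 R n) -h fnorm_skew.
Qed.

Lemma fnorm_skew_inv W Z :
  W^T = - W -> fnorm (invmx (1%:M - W) *m Z) <= fnorm Z.
Proof.
by move=> hW; apply: le_trans (fnorm_skew _ hW) _; rewrite mulKVmx // skew_unitmx.
Qed.

Lemma skew_invT W : W^T = - W -> (invmx (1%:M - W))^T = invmx (1%:M + W).
Proof. by move=> hW; rewrite trmx_inv linearB /= trmx1 hW opprK. Qed.

Lemma skewN W : W^T = - W -> (- W)^T = - - W.
Proof. by move=> hW; rewrite linearN /= hW. Qed.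

Lemma fnorm_skew_invr W Z :
  W^T = - W -> fnorm (Z *m invmx (1%:M - W)) <= fnorm Z.
Proof.
move=> hW; rewrite -fnormT trmx_mul skew_invT // -{1}[W]opprK -(fnormT Z).
by apply: fnorm_skew_inv; apply: skewN.
Qed.

End Skew.

(** Induction on the size: split off the first row and column and pass to the Schur complement
    [D' = D - a^-1 b^T b], which is again symmetric and positive definite. *)
Lemma cholesky (R : realType) (n : nat) (A : 'M[R]_n) :
  A^T = A -> (forall x : 'cV[R]_n, x != 0 -> 0 < (x^T *m A *m x) 0 0) ->
  exists T : 'M[R]_n,
    [/\ forall i j : 'I_n, (j < i)%N -> T i j = 0,
        forall i : 'I_n, 0 < T i i & A = T^T *m T].
Proof.
elim: n A => [|n IH] A sA pA.
  by exists 0; split=> [[]|[]|] //; apply/matrixP => -[].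
move: (A : 'M[R]_(1 + n)) sA pA => {}A sA pA.
have {}pA : forall x : 'cV[R]_(1 + n), x != 0 -> 0 < (x^T *m A *m x) 0 0 := pA.
pose a := A 0 0; pose b : 'rV[R]_n := ursubmx A; pose D : 'M[R]_n := drsubmx A.
have eA : A = block_mx a%:M b b^T D.
  rewrite -[LHS]submxK; congr (block_mx _ _ _ _).
    apply/matrixP => i j; rewrite !ord1 !mxE /= mulr1n /a.
    by congr (A _ _); apply/val_inj.
  by rewrite /b -{1}sA trmx_ursub.
have sD : D^T = D by rewrite /D trmx_drsub sA.
have a0 : 0 < a.
  have := pA (col_mx 1%:M 0 : 'cV[R]_(1 + n)).
  have -> : (col_mx 1%:M 0 : 'cV[R]_(1 + n)) != 0.
    apply/eqP => /(congr1 (fun M : 'cV[R]_(1 + n) => usubmx M 0 0)).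
    by rewrite col_mxKu !mxE /= => /eqP; rewrite oner_eq0.
  move=> /(_ isT); rewrite eA tr_col_mx mul_row_block mul_row_col trmx1 trmx0.
  by rewrite !mul1mx !mul0mx !mulmx0 !addr0 mulmx1 mxE /= mulr1n.
pose D' := D - a^-1 *: (b^T *m b).
have sD' : D'^T = D'.
  by rewrite /D' linearB linearZ /= trmx_mul trmxK sD.
have pD' (x : 'cV[R]_n) : x != 0 -> 0 < (x^T *m D' *m x) 0 0.
  (* For given [x] this first coordinate minimises the quadratic form of [A], and the minimum is the
     form of [D'] at [x]. *)
  move=> x0; have := pA (col_mx (- a^-1 *: (b *m x)) x : 'cV[R]_(1 + n)).
  have -> : (col_mx (- a^-1 *: (b *m x)) x : 'cV[R]_(1 + n)) != 0.
    by apply: contra x0 => /eqP /(congr1 dsubmx); rewrite col_mxKd linear0 => ->.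
  move=> /(_ isT); rewrite eA tr_col_mx mul_row_block mul_row_col.
  suff -> : ((- a^-1 *: (b *m x))^T *m a%:M + x^T *m b^T) *m (- a^-1 *: (b *m x)) +
    ((- a^-1 *: (b *m x))^T *m b + x^T *m D) *m x = x^T *m D' *m x by [].
  rewrite -!scalemxAr /D' linearZ /= mul_mx_scalar scalerA trmx_mul mulrN.
  rewrite divff ?gt_eqF // scaleN1r addNr mul0mx scaler0 add0r.
  rewrite mulmxBr mulmxBl mulmxDl addrC; congr (_ + _).
  by rewrite -scalemxAl -scalemxAl -scalemxAr -scalemxAl scaleNr !mulmxA.
have [T' [uT pT eT]] := IH _ sD' pD'.
have sa : 0 < Num.sqrt a by rewrite sqrtr_gt0.
pose T : 'M[R]_(1 + n) := block_mx (Num.sqrt a)%:M ((Num.sqrt a)^-1 *: b) 0 T'.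
suff [h1 h2 h3] : [/\ forall i j : 'I_(1 + n), (j < i)%N -> T i j = 0,
    forall i : 'I_(1 + n), 0 < T i i & A = T^T *m T] by exists T.
split.
- move=> i j; case: (split_ordP i) => i' ->; case: (split_ordP j) => j' ->.
  + by rewrite !ord1.
  + by rewrite !ord1.
  + by rewrite block_mxEdl mxE.
  + by rewrite block_mxEdr => h; apply: uT.
- move=> i; case: (split_ordP i) => i' ->.
  + by rewrite block_mxEul ord1 mxE eqxx mulr1n.
  + by rewrite block_mxEdr.
- rewrite eA /T tr_block_mx mulmx_block !trmx0 !mul0mx !addr0 tr_scalar_mx !mulmx0 ?addr0.
  rewrite -scalar_mxM -expr2 sqr_sqrtr ?ltW // mul_scalar_mx scalerA divff ?gt_eqF //.
  rewrite scale1r; congr (block_mx _ _ _ _).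
    by rewrite linearZ /= mul_mx_scalar scalerA divff ?gt_eqF // scale1r.
  rewrite -eT [(_ *: b)^T]linearZ /= -scalemxAl -scalemxAr scalerA.
  rewrite -expr2 exprVn sqr_sqrtr ?ltW //.
  by rewrite /D' addrC subrK.
Qed.

Section QR.
Variables (R : realType) (n : nat).

(** If [M^T M = T^T T] is the Cholesky factorization, then [M T^-1] is orthogonal. *)
Lemma QR_exists (M : 'M[R]_n) : M \in unitmx ->
  exists Q : 'M[R]_n, orthogonal_mx Q /\
    exists T : 'M[R]_n,
      [/\ forall i j : 'I_n, (j < i)%N -> T i j = 0,
          forall i : 'I_n, 0 < T i i & M = Q *m T].
Proof.
move=> uM; have sM : (M^T *m M)^T = M^T *m M by rewrite trmx_mul trmxK.
have pM (x : 'cV[R]_n) : x != 0 -> 0 < (x^T *m (M^T *m M) *m x) 0 0.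
  move=> x0; rewrite mulmxA -trmx_mul -mulmxA.
  set y := M *m x.
  have [k yk] : exists k, y k 0 != 0.
    apply/existsP; apply: contraR x0; rewrite negb_exists => /forallP h.
    have y0 : y = 0.
      by apply/matrixP => i j; rewrite ord1 [RHS]mxE; have := h i; rewrite negbK => /eqP.
    by rewrite -[x](mulKmx uM) -/y y0 mulmx0.
  rewrite mxE (bigD1 k) //= mxE -expr2 ltr_wpDr //.
    by apply: sumr_ge0 => i _; rewrite mxE -expr2 sqr_ge0.
  by rewrite lt_neqAle sqr_ge0 andbT eq_sym sqrf_eq0.
have [T [uT pT eT]] := cholesky sM pM.
have TU : T \in unitmx.
  have : M^T *m M \in unitmx by rewrite unitmx_mul unitmx_tr uM.
  by rewrite eT unitmx_mul => /andP[].
exists (M *m invmx T); split; last first.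
  by exists T; split=> //; rewrite mulmxKV.
rewrite /orthogonal_mx trmx_mul trmx_inv mulmxA -(mulmxA _ M^T) eT.
by rewrite mulKmx ?unitmx_tr // mulmxV.
Qed.

(** [qf] is a choice with default [0]; existence of a factorization ensures that the chosen value is
    a genuine orthogonal factor. *)
Lemma qfP (M : 'M[R]_n) : M \in unitmx ->
  orthogonal_mx (qf M) /\
    exists T : 'M[R]_n,
      [/\ forall i j : 'I_n, (j < i)%N -> T i j = 0,
          forall i : 'I_n, 0 < T i i & M = qf M *m T].
Proof.
move=> uM; have [Q hQ] := QR_exists uM.
exact: (@xgetPex _ 0 [set Q : 'M[R]_n | orthogonal_mx Q /\
    exists T : 'M[R]_n,
      [/\ forall i j : 'I_n, (j < i)%N -> T i j = 0,
          forall i : 'I_n, 0 < T i i & M = Q *m T]] (ex_intro _ Q hQ)).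
Qed.

(* [Y] is lower triangular with diagonal [1 / T i i], so off the diagonal [T]
   and [Y] do not interact, and [|t - 1| <= |t - 1 / t|] for [t > 0]. *)
Lemma fnorm_sub_invT (T Y : 'M[R]_n) :
  (forall i j : 'I_n, (j < i)%N -> T i j = 0) -> (forall i, 0 < T i i) ->
  T^T *m Y = 1%:M -> fnorm (T - 1%:M) <= fnorm (T - Y).
Proof.
move=> uT pT eY.
have sumY (i j : 'I_n) : (forall k : 'I_n, (k < i)%N -> Y k j = 0) ->
    T i i * Y i j = (i == j)%:R.
  move=> h; move/matrixP/(_ i j): eY; rewrite !mxE (bigD1 i) //= mxE big1.
    by rewrite addr0.
  move=> k ki; rewrite mxE; have [lt|gt|/val_inj e] := ltngtP k i.
  - by rewrite h // mulr0.
  - by rewrite uT // mul0r.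
  - by rewrite e eqxx in ki.
(* Forward substitution in [T^T Y = 1]: [m] counts the rows of [Y] already known to vanish to the
   right of the diagonal. *)
have lY m : forall i j : 'I_n, (i < m)%N -> (i < j)%N -> Y i j = 0.
  elim: m => [//|m IHm] i j im ij.
  have : T i i * Y i j = 0.
    rewrite sumY; first by rewrite -val_eqE /= ltn_eqF.
    by move=> k ki; apply: IHm; [apply: leq_trans ki _|apply: ltn_trans ki _].
  by move/eqP; rewrite mulf_eq0 gt_eqF //= => /eqP.
have dY i : T i i * Y i i = 1.
  by rewrite sumY ?eqxx // => k ki; apply: (lY n).
apply: fnorm_le; rewrite ?fnorm_ge0 // fnorm_sqr !frobE.
apply: ler_sum => i _; apply: ler_sum => j _; rewrite -!expr2 !mxE.
have [lt|gt|/val_inj ->] := ltngtP i j.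
- by rewrite (lY n) // -val_eqE ltn_eqF.
- by rewrite uT // -val_eqE gtn_eqF // subr0 expr0n sqr_ge0.
- rewrite eqxx; have := dY j; have := pT j; move: (T j j) (Y j j) => t y t0 ty.
  have tn : t != 0 by rewrite gt_eqF.
  have -> : y = t^-1 by rewrite -[y]mul1r -(mulVf tn) -mulrA ty mulr1.
  have -> : t - t^-1 = (t - 1) * (1 + t^-1) by field; rewrite gt_eqF.
  rewrite exprMn ler_peMr ?sqr_ge0 //; have : 0 < t^-1 by rewrite invr_gt0.
  nra.
Qed.

(* Writing [1 + W = P T], one has [T - T^-T = - P^T (1 - W)^-1 W^2]. *)
Lemma fnorm_qf_sub (Q W : 'M[R]_n) : orthogonal_mx Q -> W^T = - W ->
  fnorm (qf (Q + Q *m W) - (Q + Q *m W)) <= fnorm W ^+ 2.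
Proof.
move=> hQ hW; have hW' := skewN hW.
have u1 : 1%:M + W \in unitmx by rewrite -[W]opprK skew_unitmx.
have eM : Q + Q *m W = Q *m (1%:M + W) by rewrite mulmxDr mulmx1.
have uQ : Q \in unitmx by case/mulmx1_unit: hQ.
have uM : Q + Q *m W \in unitmx by rewrite eM unitmx_mul uQ.
have [oP [T [uT pT eT]]] := qfP uM; set P0 := qf _ in oP eT *.
pose P := Q^T *m P0.
have oP' : orthogonal_mx P.
  by rewrite /orthogonal_mx trmx_mul trmxK mulmxA -(mulmxA _ Q) orthogonal_mxT // mulmx1.
have e1 : 1%:M + W = P *m T.
  by rewrite -mulmxA -eT eM mulmxA hQ mul1mx.
have -> : P0 - (Q + Q *m W) = P0 *m (1%:M - T) by rewrite {1}eT mulmxBr mulmx1.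
rewrite fnorm_orthl // -fnormN opprB.
(* Since [T^T P^T = (1 + W)^T = 1 - W], this is the inverse transpose of [T]. *)
pose Y := P^T *m invmx (1%:M - W).
have eY : T^T *m Y = 1%:M.
  rewrite /Y mulmxA -trmx_mul -e1 linearD /= trmx1 hW mulmxV //.
  exact: skew_unitmx.
apply: le_trans (fnorm_sub_invT uT pT eY) _.
have -> : T - Y = - (P^T *m (invmx (1%:M - W) *m (W *m W))).
  have -> : T = P^T *m (1%:M + W) by rewrite e1 mulmxA oP' mul1mx.
  rewrite /Y -mulmxBr -mulmxN; congr (_ *m _).
  apply: (can_inj (mulKmx (skew_unitmx hW))).
  rewrite mulmxBr mulmxN mulmxV ?skew_unitmx // mulKVmx ?skew_unitmx //.
  rewrite mulmxDr mulmx1 mulmxBl mul1mx.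
  by rewrite addrA subrK addrAC subrr add0r.
rewrite fnormN fnorm_orthl; last exact: orthogonal_trmx.
by apply: le_trans (fnorm_skew_inv _ hW) _; rewrite expr2 fnormM.
Qed.

End QR.

(** * The differential of G and its adjoint *)


Lemma lipschitz_continuous (R : realType) (V W : normedModType R) (f : V -> W) (C : R) :
  (forall x y, `|f x - f y| <= C * `|x - y|) -> continuous f.
Proof.
move=> h x; apply/cvgrPdist_le => /= e e0.
have C0 : 0 < `|C| + 1 by rewrite ltr_wpDl.
near=> y; apply: le_trans (h x y) _.
apply: (@le_trans _ _ ((`|C| + 1) * `|x - y|)).
  by apply: ler_wpM2r => //; apply: le_trans (ler_norm _) _; rewrite lerDl.
rewrite -ler_pdivlMl // mulrC.
near: y; apply: cvgr_dist_le; [exact: cvg_id|exact: divr_gt0].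
Unshelve. all: by end_near. Qed.

Section DiffG.
Variables (R : realType) (n : nat) (L : 'M[R]_n).
Implicit Types X xi : ambient R n.

(** The product rule applied to [G L]. As a formula on all of [ambient] it can be compared at two
    base points and evaluated at vectors that are not tangent. *)
Definition dG X xi : 'M[R]_n :=
  hadamard X.1.1 xi.1.1 *+ 2
  - (xi.1.2 *m (L + X.2) *m X.1.2^T + X.1.2 *m xi.2 *m X.1.2^T
     + X.1.2 *m (L + X.2) *m xi.1.2^T).

Lemma hadamardDl A B C : hadamard (A + B) C = hadamard A C + hadamard B C :> 'M[R]_n.
Proof. by apply/matrixP => i j; rewrite !mxE mulrDl. Qed.

Lemma hadamardDr A B C : hadamard A (B + C) = hadamard A B + hadamard A C :> 'M[R]_n.
Proof. by apply/matrixP => i j; rewrite !mxE mulrDr. Qed.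

Lemma hadamardZr a A B : hadamard A (a *: B) = a *: hadamard A B :> 'M[R]_n.
Proof. by apply/matrixP => i j; rewrite !mxE mulrCA. Qed.

Lemma dG_linear X : linear (dG X).
Proof.
move=> a x y; rewrite /dG /= hadamardDr hadamardZr.
rewrite [(_ + _)^T]linearP /= !(mulmxDl, mulmxDr) -!(scalemxAl, scalemxAr).
do ?[move: (_ *m _)]; move: (hadamard _ _) (hadamard _ _) => *.
by apply/matrixP => i j; rewrite !mxE; ring.
Qed.

(** [G] is a cubic polynomial, so its Taylor expansion stops; the last bracket collects all terms of
    order two and three in [xi]. *)
Lemma G_expand X xi :
  G L (X + xi) = G L X + dG X xi + (hadamard xi.1.1 xi.1.1 -
    (xi.1.2 *m xi.2 *m X.1.2^T + xi.1.2 *m (L + X.2) *m xi.1.2^T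
     + X.1.2 *m xi.2 *m xi.1.2^T + xi.1.2 *m xi.2 *m xi.1.2^T)).
Proof.
rewrite /G /dG /= !(hadamardDr, hadamardDl).
have -> : hadamard xi.1.1 X.1.1 = hadamard X.1.1 xi.1.1.
  by apply/matrixP => i j; rewrite !mxE mulrC.
rewrite [(_ + _)^T]linearD /=.
rewrite !(mulmxDl, mulmxDr).
do ?[move: (_ *m _)]; move: (hadamard _ _) (hadamard _ _) (hadamard _ _) => *.
by apply/matrixP => i j; rewrite !mxE; ring.
Qed.

Lemma fnormM3_le (A B C : 'M[R]_n) (a b c : R) :
  fnorm A <= a -> fnorm B <= b -> fnorm C <= c -> fnorm (A *m B *m C) <= a * b * c.
Proof.
move=> hA hB hC; apply: le_trans (fnormM _ _) _.
apply: ler_pM; rewrite ?fnorm_ge0 //; apply: le_trans (fnormM _ _) _.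
by rewrite ler_pM ?fnorm_ge0.
Qed.

Lemma fnorm_dG (B : R) X xi : mnorm X <= B ->
  fnorm (dG X xi) <= (2 * B + 2 * B * (fnorm L + B) + B ^+ 2) * mnorm xi.
Proof.
move=> hB; have [h1 h2 h3] := fnorm_mnorm X; have [k1 k2 k3] := fnorm_mnorm xi.
have B0 : 0 <= B by apply: le_trans hB; apply: mnorm_ge0.
have hM : fnorm (L + X.2) <= fnorm L + B.
  by apply: le_trans (fnormD _ _) _; rewrite lerD2l; apply: le_trans hB.
have hQ : fnorm X.1.2 <= B by apply: le_trans hB.
have hS : fnorm X.1.1 <= B by apply: le_trans hB.
have M0 := fnorm_ge0 (L + X.2).
rewrite /dG; apply: le_trans (fnormB _ _) _.
apply: le_trans (lerD (lexx _) (fnormD _ _)) _.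
apply: le_trans (lerD (lexx _) (lerD (fnormD _ _) (lexx _))) _.
have e1 : fnorm (hadamard X.1.1 xi.1.1 *+ 2) <= 2 * (B * mnorm xi).
  rewrite -scaler_nat fnormZ ger0_norm // ler_wpM2l //.
  by apply: le_trans (fnorm_hadamard _ _) _; apply: ler_pM; rewrite ?fnorm_ge0.
have e2 := @fnormM3_le _ _ X.1.2^T _ _ B k2 hM.
have e3 := @fnormM3_le _ _ X.1.2^T _ _ B hQ k3.
have e4 := @fnormM3_le _ _ xi.1.2^T _ _ _ hQ hM; rewrite fnormT in e4.
rewrite !fnormT in e2 e3.
have := e4 _ k2; have := e3 hQ; have := e2 hQ; lra.
Qed.

(** Of the constant, the Hadamard square gives [1], the cubic term [1] because [|xi| <= 1], and the
    three quadratic products give [B], [fnorm L + B] and [B]. *)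
Lemma G_taylor (B : R) X xi : mnorm X <= B -> mnorm xi <= 1 ->
  fnorm (G L (X + xi) - G L X - dG X xi) <= (2 + fnorm L + 3 * B) * mnorm xi ^+ 2.
Proof.
move=> hB hx; have [h1 h2 h3] := fnorm_mnorm X; have [k1 k2 k3] := fnorm_mnorm xi.
have x0 := mnorm_ge0 xi.
have B0 : 0 <= B by apply: le_trans hB; apply: mnorm_ge0.
have hM : fnorm (L + X.2) <= fnorm L + B.
  by apply: le_trans (fnormD _ _) _; rewrite lerD2l; apply: le_trans hB.
have hQ : fnorm X.1.2 <= B by apply: le_trans hB.
have M0 := fnorm_ge0 (L + X.2).
have sub3 (a b c : 'M[R]_n) : a + b + c - a - b = c.
  by apply/matrixP => i j; rewrite !mxE; ring.
rewrite G_expand sub3.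
apply: le_trans (fnormB _ _) _.
apply: le_trans (lerD (fnorm_hadamard _ _) (fnormD _ _)) _.
apply: le_trans (lerD (lexx _) (lerD (fnormD _ _) (lexx _))) _.
apply: le_trans (lerD (lexx _) (lerD (lerD (fnormD _ _) (lexx _)) (lexx _))) _.
have e0 : fnorm xi.1.1 * fnorm xi.1.1 <= mnorm xi * mnorm xi.
  by rewrite ler_pM ?fnorm_ge0.
have e1 := @fnormM3_le _ _ X.1.2^T _ _ B k2 k3.
have e2 := @fnormM3_le _ _ xi.1.2^T _ _ (mnorm xi) k2 hM.
have e3 := @fnormM3_le _ _ xi.1.2^T _ _ (mnorm xi) hQ k3.
have e4 := @fnormM3_le _ _ xi.1.2^T _ _ (mnorm xi) k2 k3.
rewrite !fnormT in e1 e2 e3 e4.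
have := e1 hQ; have := e2 k2; have := e3 k2; have := e4 k2.
have : mnorm xi * mnorm xi * mnorm xi <= mnorm xi * mnorm xi.
  by rewrite ler_piMr ?mulr_ge0.
lra.
Qed.

(** By uniqueness of the differential it suffices that [dG X] is continuous and that the Taylor
    remainder is [o(|y|)] in the library norm; [N = 3 n] converts [mnorm] into that norm. *)
Lemma DGE X xi : DG L X xi = dG X xi.
Proof.
pose f : {linear ambient R n -> 'M[R]_n} := HB.pack (dG X)
  (GRing.isLinear.Build _ _ _ _ _ (dG_linear X)).
have fE : f = dG X :> (_ -> _) by [].
rewrite /DG (@diff_unique _ _ _ (G L) f X); [by rewrite fE| |].
- set c := 2 * mnorm X + 2 * mnorm X * (fnorm L + mnorm X) + mnorm X ^+ 2.
  have c0 : 0 <= c by rewrite !addr_ge0 ?mulr_ge0 ?addr_ge0 ?mnorm_ge0 ?fnorm_ge0.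
  apply: (@lipschitz_continuous _ _ _ _ (c * (3 * n%:R))) => x y.
  rewrite -linearB fE; apply: le_trans (normr_fnorm _) _.
  apply: le_trans (fnorm_dG _ (lexx _)) _; rewrite -/c -(mulrA c) ler_wpM2l //.
  exact: mnorm_normr.
- apply/eqaddoP => e e0; rewrite fE.
  set K := 2 + fnorm L + 3 * mnorm X; set N : R := 3 * n%:R.
  have K0 : 0 <= K by rewrite !addr_ge0 ?mulr_ge0 ?mnorm_ge0 ?fnorm_ge0.
  have N0 : 0 <= N by rewrite mulr_ge0.
  have D0 : 0 < K * N ^+ 2 + 1 by rewrite ltr_wpDl // mulr_ge0 // sqr_ge0.
  have N1 : 0 < N + 1 by rewrite ltr_wpDl.
  near=> y.
  have hy1 : `|y| <= (N + 1)^-1.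
    near: y; apply: (@nbhs0_le R (ambient R n)); by rewrite invr_gt0.
  have hy2 : `|y| <= e / (K * N ^+ 2 + 1).
    near: y; apply: (@nbhs0_le R (ambient R n)); by rewrite divr_gt0.
  have my := mnorm_normr y; rewrite -/N in my.
  have my1 : mnorm y <= 1.
    apply: le_trans my _; apply: (@le_trans _ _ ((N + 1) * (N + 1)^-1)).
      by apply: ler_pM => //; lra.
    by rewrite mulfV // gt_eqF //; lra.
  rewrite /= !fctE /shift /= [y + X]addrC opprD addrA.
  apply: le_trans (normr_fnorm _) _; apply: le_trans (G_taylor (lexx _) my1) _.
  rewrite -/K; apply: (@le_trans _ _ (K * (N * `|y|) ^+ 2)).
    by rewrite ler_wpM2l // lerXn2r ?nnegrE ?mnorm_ge0 // mulr_ge0.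
  have -> : K * (N * `|y|) ^+ 2 = (K * N ^+ 2 * `|y|) * `|y| by ring.
  rewrite ler_wpM2r //.
  rewrite ler_pdivlMr // in hy2; apply: le_trans hy2.
  by rewrite mulrC ler_wpM2l //; lra.
Unshelve. all: by end_near. Qed.

End DiffG.

Section Adjoint.
Variables (R : realType) (n : nat).
Implicit Types A B C Q : 'M[R]_n.

Lemma frob_mull A B C : frob (A *m B) C = frob B (A^T *m C).
Proof. by rewrite /frob trmx_mul mulmxA. Qed.

Lemma frob_mulr A B C : frob (A *m B) C = frob A (C *m B^T).
Proof. by rewrite /frob trmx_mul -mulmxA mxtrace_mulC -mulmxA. Qed.

Lemma frob_tr A B : frob A^T B = frob A B^T.
Proof. by rewrite /frob trmxK -mxtrace_tr trmx_mul mxtrace_mulC. Qed.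

Lemma frob_hadamard A B C : frob (hadamard A B) C = frob B (hadamard A C).
Proof.
rewrite !frobE; apply: eq_bigr => i _; apply: eq_bigr => j _.
by rewrite !mxE; ring.
Qed.

(** Put [M = L + V] and [W = Q^T Z Q]. For a tangent [Q Omega], the terms in [Omega] pair with [Z]
    to [- frob Omega K], and only the skew part [(K - K^T) / 2] of [K] is seen. The last block is
    minus the orthogonal projection of [W] onto [Vspace L]. *)
Definition adjG (L : 'M[R]_n) (X : ambient R n) (Z : 'M[R]_n) : ambient R n :=
  let W := X.1.2^T *m Z *m X.1.2 in
  let K := W *m (L + X.2)^T - (L + X.2)^T *m W in
  (hadamard X.1.1 Z *+ 2, X.1.2 *m (- 2^-1 *: (K - K^T)),
   - \matrix_(i, j) if (j <= i)%N || (L i j != 0) then 0 else W i j).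

Lemma adjGP L (X : ambient R n) Z : orthogonal_mx X.1.2 ->
  tangent L X (adjG L X Z) /\
  forall xi : ambient R n, tangent L X xi ->
    frob (DG L X xi) Z = metric xi (adjG L X Z).
Proof.
move=> hQ; rewrite /adjG; set W := _ *m Z *m _; set M := L + X.2.
set K := W *m M^T - M^T *m W; split.
  split=> /=.
    exists (- 2^-1 *: (K - K^T)) => //.
    by rewrite linearZ /= linearB /= trmxK -[RHS]scalerN [- (K - _)]opprB.
  by move=> i j h; rewrite !mxE h oppr0.
move=> [[a z] e] [[Om sOm /= ->] hV]; rewrite DGE /dG /metric /= -/M.
have eS : frob (hadamard X.1.1 a *+ 2) Z = frob a (hadamard X.1.1 Z *+ 2).
  by rewrite !mulr2n frobDl frobDr frob_hadamard.
rewrite frobDl frobNl eS !frobDl.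
have fc A : frob (X.1.2 *m A *m X.1.2^T) Z = frob A W.
  by rewrite frob_mulr trmxK frob_mull mulmxA.
have fc1 : frob (X.1.2 *m Om *m M *m X.1.2^T) Z = frob Om (W *m M^T).
  by rewrite -(mulmxA X.1.2) fc frob_mulr.
have fc2 : frob (X.1.2 *m M *m (X.1.2 *m Om)^T) Z = - frob Om (M^T *m W).
  rewrite trmx_mul mulmxA -(mulmxA X.1.2) fc sOm mulmxN frobNl.
  by rewrite frob_mull.
have fO A : frob Om A^T = - frob Om A by rewrite -frob_tr sOm frobNl.
have eO : frob (X.1.2 *m Om) (X.1.2 *m (- 2^-1 *: (K - K^T))) = - frob Om K.
  rewrite frob_mull mulmxA hQ mul1mx frobZr frobDr frobNr fO.
  by field.
have eV : frob e W =
    frob e (\matrix_(i, j) if (j <= i)%N || (L i j != 0) then 0 else W i j).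
  rewrite !frobE; apply: eq_bigr => i _; apply: eq_bigr => j _; rewrite [X in _ = _ * X]mxE.
  by case: ifP => // h; rewrite (hV _ _ h) !mul0r.
rewrite fc1 fc2 fc eO frobNr -eV /K (frobDr Om) (frobNr Om).
by ring.
Qed.

(** [DGadj] is a choice with default [0]; [adjG] shows that there is something to choose from. *)
Lemma DGadjP L (X : ambient R n) Z : orthogonal_mx X.1.2 ->
  tangent L X (DGadj L X Z) /\
  forall xi : ambient R n, tangent L X xi -> frob (DG L X xi) Z = metric xi (DGadj L X Z).
Proof.
move=> hQ; rewrite /DGadj; case: xgetP => [W -> //|/(_ (adjG L X Z))].
by case; apply: adjGP.
Qed.
End Adjoint.

(** * Estimates near a point where DG is surjective *)


Section Local.
Variables (R : realType) (n : nat) (L : 'M[R]_n).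
Implicit Types X Y xi : ambient R n.

Lemma ambient_eq X Y : X.1.1 = Y.1.1 -> X.1.2 = Y.1.2 -> X.2 = Y.2 -> X = Y.
Proof. by case: X => -[? ?] ?; case: Y => -[? ?] ? /= -> -> ->. Qed.

Lemma tangent0 X : tangent L X 0.
Proof.
split; last by move=> i j _; rewrite mxE.
by exists 0; rewrite ?mulmx0 // linear0 oppr0.
Qed.

Lemma tangentD X xi zeta : tangent L X xi -> tangent L X zeta -> tangent L X (xi + zeta).
Proof.
move=> [[A hA eA] hV] [[B hB eB] hV']; split.
  exists (A + B); first by rewrite linearD /= hA hB opprD.
  by rewrite /= eA eB mulmxDr.
by move=> i j h; rewrite mxE hV // hV' // addr0.
Qed.

Lemma tangentZ X a xi : tangent L X xi -> tangent L X (a *: xi).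
Proof.
move=> [[A hA eA] hV]; split.
  exists (a *: A); first by rewrite linearZ /= hA scalerN.
  by rewrite /= eA scalemxAr.
by move=> i j h; rewrite mxE hV // mulr0.
Qed.

Lemma mnorm_sum (I : Type) (r : seq I) (F : I -> ambient R n) :
  mnorm (\sum_(i <- r) F i) <= \sum_(i <- r) mnorm (F i).
Proof.
elim: r => [|i r IH]; first by rewrite !big_nil mnorm0.
by rewrite !big_cons; apply: le_trans (mnormD _ _) _; rewrite lerD2l.
Qed.

(** Combine linearly chosen preimages of the elementary matrices. The extra [1] in the constant
    keeps it positive. *)
Lemma bounded_right_inverse X :
  set_surj (tangent L X) [set: 'M[R]_n] (DG L X) ->
  exists2 C, 0 < C & forall Z, exists xi,
    [/\ tangent L X xi, DG L X xi = Z & mnorm xi <= C * fnorm Z].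
Proof.
move=> hsurj.
have /choice[f hf] (ij : 'I_n * 'I_n) :
    exists xi, tangent L X xi /\ DG L X xi = delta_mx ij.1 ij.2.
  by have [xi h1 h2] := hsurj (delta_mx ij.1 ij.2) I; exists xi.
exists (\sum_ij mnorm (f ij) + 1).
  by rewrite ltr_wpDl // sumr_ge0 // => ij _; apply: mnorm_ge0.
move=> Z; exists (\sum_ij Z ij.1 ij.2 *: f ij); split.
- elim/big_ind : _ => [|x y|ij _]; [exact: tangent0|exact: tangentD|].
  by apply: tangentZ; case: (hf ij).
- rewrite /DG linear_sum /= [RHS]matrix_sum_delta pair_bigA /=.
  by apply: eq_bigr => ij _; rewrite linearZ /=; congr (_ *: _); case: (hf ij).
- apply: le_trans (mnorm_sum _ _) _.
  rewrite mulrDl mul1r mulr_suml ler_wpDr ?fnorm_ge0 //.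
  apply: ler_sum => ij _; rewrite mnormZ mulrC ler_wpM2l ?mnorm_ge0 //.
  exact: fnorm_entry.
Qed.

Lemma mnorm_Q (A : 'M[R]_n) : mnorm ((0, A, 0) : ambient R n) = fnorm A.
Proof.
by rewrite /mnorm /metric /= /fnorm /frob mulmx0 linear0 add0r addr0.
Qed.

Lemma mnorm_retraction X xi : orthogonal_mx X.1.2 -> tangent L X xi ->
  mnorm (retraction X xi - (X + xi)) <= mnorm xi ^+ 2.
Proof.
move=> hQ [[W hW eW] _].
have -> : retraction X xi - (X + xi) =
    (0, qf (X.1.2 + xi.1.2) - (X.1.2 + xi.1.2), 0) :> ambient R n.
  by apply: ambient_eq; rewrite /= ?subrr.
rewrite mnorm_Q eW; apply: le_trans (fnorm_qf_sub hQ hW) _.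
have [_ h _] := fnorm_mnorm xi; rewrite eW fnorm_orthl // in h.
by rewrite lerXn2r ?nnegrE ?fnorm_ge0 ?mnorm_ge0.
Qed.

(** Each of the three products is telescoped one factor at a time, giving two terms each: four
    contribute [B] and two contribute [fnorm L + B]. The [2] comes from the Hadamard part. *)
Lemma dG_lipschitz (B : R) X Y xi : mnorm X <= B -> mnorm Y <= B ->
  fnorm (dG L X xi - dG L Y xi)
    <= (2 + 6 * B + 2 * fnorm L) * mnorm (X - Y) * mnorm xi.
Proof.
move=> hX hY.
have [D1 D2 D3] := fnorm_mnorm (X - Y); have [k1 k2 k3] := fnorm_mnorm xi.
have [_ x2 x3] := fnorm_mnorm X; have [_ y2 y3] := fnorm_mnorm Y.
set d := mnorm (X - Y) in D1 D2 D3 *; set x := mnorm xi in k1 k2 k3 *.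
have d0 : 0 <= d by apply: mnorm_ge0.
have x0 : 0 <= x by apply: mnorm_ge0.
have hMY : fnorm (L + Y.2) <= fnorm L + B.
  by apply: le_trans (fnormD _ _) _; rewrite lerD2l; apply: le_trans hY.
have hMX : fnorm (L + X.2) <= fnorm L + B.
  by apply: le_trans (fnormD _ _) _; rewrite lerD2l; apply: le_trans hX.
have xQ := le_trans x2 hX; have yQ := le_trans y2 hY.
have -> : dG L X xi - dG L Y xi = hadamard (X - Y).1.1 xi.1.1 *+ 2
   - (xi.1.2 *m (X - Y).2 *m X.1.2^T + xi.1.2 *m (L + Y.2) *m ((X - Y).1.2)^T
      + (X - Y).1.2 *m xi.2 *m X.1.2^T + Y.1.2 *m xi.2 *m ((X - Y).1.2)^T
      + (X - Y).1.2 *m (L + X.2) *m xi.1.2^T + Y.1.2 *m (X - Y).2 *m xi.1.2^T).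
  rewrite /dG /= hadamardDl.
  have -> : hadamard (- Y.1.1) xi.1.1 = - hadamard Y.1.1 xi.1.1.
    by apply/matrixP => i j; rewrite !mxE mulNr.
  rewrite [(X.1.2 - Y.1.2)^T]linearB /=.
  rewrite !(mulmxDl, mulmxDr, mulNmx, mulmxN).
  do ?[move: (_ *m _)]; move: (hadamard _ _) (hadamard _ _) => *.
  by apply/matrixP => i j; rewrite !mxE; ring.
have e0 : fnorm (hadamard (X - Y).1.1 xi.1.1 *+ 2) <= 2 * (d * x).
  rewrite -scaler_nat fnormZ ger0_norm // ler_wpM2l //.
  apply: le_trans (fnorm_hadamard _ _) _.
  exact: ler_pM (fnorm_ge0 _) (fnorm_ge0 _) D1 k1.
have e1 := @fnormM3_le R n _ _ X.1.2^T _ _ B k2 D3.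
have e2 := @fnormM3_le R n _ _ ((X - Y).1.2)^T _ _ d k2 hMY.
have e3 := @fnormM3_le R n _ _ X.1.2^T _ _ B D2 k3.
have e4 := @fnormM3_le R n _ _ ((X - Y).1.2)^T _ _ d yQ k3.
have e5 := @fnormM3_le R n _ _ xi.1.2^T _ _ x D2 hMX.
have e6 := @fnormM3_le R n _ _ xi.1.2^T _ _ x yQ D3.
rewrite !fnormT in e1 e2 e3 e4 e5 e6.
move: (e1 xQ) (e2 D2) (e3 xQ) (e4 D2) (e5 k2) (e6 k2) e0.
have tri6 (a b c e f g h : 'M[R]_n) : fnorm (a - (b + c + e + f + g + h)) <=
    fnorm a + (fnorm b + fnorm c + fnorm e + fnorm f + fnorm g + fnorm h).
  apply: le_trans (fnormB _ _) _; rewrite lerD2l.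
  do 4! (apply: le_trans (fnormD _ _) _; rewrite lerD2r).
  exact: fnormD.
move=> {}e1 {}e2 {}e3 {}e4 {}e5 {}e6 {}e0.
apply: le_trans (tri6 _ _ _ _ _ _ _) _.
by move: e1 e2 e3 e4 e5 e6 e0; clear => *; lra.
Qed.

(** Write [Z = DG Xbar xi] with [|xi| <= C |Z|] and transport [xi] to [xi'], tangent at [X]. Up to
    an error of at most [|Z| / 2], [Z] is [DG X xi'], so [|Z|^2 <= |xi'| |DGadj X Z| + |Z|^2 / 2];
    this gives [kappa = 2 C]. *)
Lemma adjoint_bounded_below Xbar : manifold L Xbar ->
  set_surj (tangent L Xbar) [set: 'M[R]_n] (DG L Xbar) ->
  exists r kappa, [/\ 0 < r, 0 < kappa & forall X, manifold L X ->
    mnorm (X - Xbar) <= r -> forall Z, fnorm Z <= kappa * mnorm (DGadj L X Z)].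
Proof.
move=> [hQb hVb] /bounded_right_inverse[C C0 hC].
set B := mnorm Xbar + 1.
set K1 := 2 * B + 2 * B * (fnorm L + B) + B ^+ 2; set K2 := 2 + 6 * B + 2 * fnorm L.
have fL := fnorm_ge0 L; have B0 : 0 <= B by rewrite addr_ge0 ?mnorm_ge0.
have K10 : 0 <= K1 by rewrite !addr_ge0 ?mulr_ge0 ?sqr_ge0 ?addr_ge0 ?mnorm_ge0.
have K20 : 0 <= K2 by rewrite !addr_ge0 ?mulr_ge0 ?mnorm_ge0.
have K12 : 0 <= K1 + K2 by exact: addr_ge0.
have KC0 : 0 <= (K1 + K2) * C by exact: mulr_ge0 (ltW _).
(* Makes the transport error [(K1 + K2) |X - Xbar| |xi|] at most [|Z| / 2]; the summand [1] also
   gives [r <= 1], so that [X] stays within norm [B]. *)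
pose r := (2 * ((K1 + K2) * C + 1))^-1.
have r0 : 0 < r by rewrite invr_gt0 mulr_gt0 // ltr_wpDl.
have rl : (K1 + K2) * C * r <= 2^-1.
  have hk : 0 < (K1 + K2) * C + 1 by rewrite ltr_wpDl.
  rewrite /r invfM mulrCA ler_piMr // ?invr_ge0 // ler_pdivrMr //; lra.
have r1 : r <= 1.
  by rewrite /r invf_le1 ?mulr_gt0 ?ltr_wpDl //; lra.
exists r, (2 * C); split=> //.
  by rewrite mulr_gt0.
move=> X [hQ hV] hr Z.
have [xi [[[W hW eW] hV1] hDG hxi]] := hC Z.
have hX : mnorm X <= B.
  by rewrite -[X](subrK Xbar) addrC; apply: le_trans (mnormD _ _) _;
     rewrite lerD2l (le_trans hr).
have hXb : mnorm Xbar <= B by rewrite lerDl.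
(* Same skew generator [W], new base point: tangent at [X], of the same norm, and differing from
   [xi] by [(Q - Qbar) W] only. *)
pose xi' : ambient R n := (xi.1.1, X.1.2 *m W, xi.2).
have txi' : tangent L X xi' by split=> //; exists W.
have nxi' : mnorm xi' = mnorm xi.
  by rewrite /mnorm /metric /= eW -!fnorm_sqr !fnorm_orthl.
have [hS hP] := DGadjP L Z hQ.
have exi : xi' - xi = (0, (X - Xbar).1.2 *m W, 0) :> ambient R n.
  by apply: ambient_eq; rewrite /= ?subrr // eW mulmxBl.
have [_ dQ _] := fnorm_mnorm (X - Xbar).
have [_ xW _] := fnorm_mnorm xi; rewrite eW fnorm_orthl // in xW.
have d1 : fnorm (dG L X (xi' - xi)) <= K1 * (mnorm (X - Xbar) * mnorm xi).
  apply: le_trans (fnorm_dG _ _ hX) _; rewrite ler_wpM2l // exi mnorm_Q.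
  by apply: le_trans (fnormM _ _) _; rewrite ler_pM ?fnorm_ge0.
have d2 := dG_lipschitz xi hX hXb; rewrite -/K2 in d2.
have eZ : Z = DG L X xi' - (dG L X (xi' - xi) + (dG L X xi - dG L Xbar xi)).
  have -> : dG L X (xi' - xi) = DG L X xi' - dG L X xi.
    by rewrite -!DGE /DG linearB.
  by rewrite addrA subrK opprB addrC subrK -DGE.
have hz : fnorm Z ^+ 2 <= mnorm xi * mnorm (DGadj L X Z) +
    (K1 + K2) * (mnorm (X - Xbar) * mnorm xi) * fnorm Z.
  rewrite fnorm_sqr {1}eZ frobDl frobNl hP //; apply: lerD.
    by apply: le_trans (ler_norm _) _; rewrite -nxi'; apply: ler_metric_mnorm.
  rewrite -frobNl; apply: le_trans (ler_norm _) _.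
  apply: le_trans (ler_frob_fnorm _ _) _; rewrite ler_wpM2r ?fnorm_ge0 // fnormN.
  by apply: le_trans (fnormD _ _) _; rewrite mulrDl lerD // mulrA.
set z := fnorm Z in hz hxi *; have z0 : 0 <= z by apply: fnorm_ge0.
set w := mnorm (DGadj L X Z) in hz *; have w0 : 0 <= w by apply: mnorm_ge0.
have h1 : mnorm xi * w <= C * z * w by rewrite ler_wpM2r.
have h2 : (K1 + K2) * (mnorm (X - Xbar) * mnorm xi) * z <= 2^-1 * z * z.
  rewrite ler_wpM2r //; apply: (@le_trans _ _ ((K1 + K2) * (r * (C * z)))).
    by rewrite (ler_wpM2l K12) // ler_pM ?mnorm_ge0 // ltW.
  have -> : (K1 + K2) * (r * (C * z)) = (K1 + K2) * C * r * z by ring.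
  by rewrite ler_wpM2r.
have [->|zn] := eqVneq z 0; first by rewrite !mulr_ge0 // ltW.
have zp : 0 < z by rewrite lt_neqAle eq_sym zn.
rewrite -(ler_pM2r zp); lra.
Qed.

(** Write the retracted point as [X + xi'] with [|xi' - xi| <= |xi|^2]. Then [|xi'| <= 2 |xi| <= 1],
    the Taylor remainder along [xi'] costs [4 K2 |xi|^2], and exchanging [xi'] for [xi] in the
    linear term costs [K1 |xi|^2]. *)
Lemma retraction_bounds Xbar : orthogonal_mx Xbar.1.2 ->
  exists2 K, 0 < K &
    (forall X xi, manifold L X -> mnorm (X - Xbar) <= 1 -> tangent L X xi ->
      mnorm xi <= 2^-1 ->
      fnorm (G L (retraction X xi) - G L X - DG L X xi) <= K * mnorm xi ^+ 2) /\
    (forall X, mnorm (X - Xbar) <= 1 ->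
      fnorm (G L X - G L Xbar) <= K * mnorm (X - Xbar)).
Proof.
move=> hQb; set B := mnorm Xbar + 1.
set K1 := 2 * B + 2 * B * (fnorm L + B) + B ^+ 2; set K2 := 2 + fnorm L + 3 * B.
have fL := fnorm_ge0 L; have B0 : 0 <= B by rewrite addr_ge0 ?mnorm_ge0.
have K10 : 0 <= K1 by rewrite !addr_ge0 ?mulr_ge0 ?sqr_ge0 ?addr_ge0 ?mnorm_ge0.
have K20 : 0 < K2 by rewrite /K2 -addrA ltr_wpDr // addr_ge0 // mulr_ge0.
exists (4 * K2 + K1); first by rewrite ltr_wpDr // mulr_gt0.
split=> [X xi [hQ hV] hX ht hxi|X hX].
  have hXB : mnorm X <= B.
    by rewrite -[X](subrK Xbar) addrC; apply: le_trans (mnormD _ _) _; rewrite lerD2l.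
  have he := mnorm_retraction hQ ht; set x := mnorm xi in hxi he *.
  have x0 : 0 <= x by apply: mnorm_ge0.
  set xi' := retraction X xi - X.
  have exi : xi' - xi = retraction X xi - (X + xi) by rewrite opprD addrA.
  have hxi' : mnorm xi' <= 2 * x.
    rewrite -[xi'](subrK xi); apply: le_trans (mnormD _ _) _; rewrite exi -/x.
    nra.
  have -> : retraction X xi = X + xi' by rewrite addrC subrK.
  have -> : G L (X + xi') - G L X - DG L X xi =
      (G L (X + xi') - G L X - dG L X xi') + dG L X (xi' - xi).
    have -> : dG L X (xi' - xi) = dG L X xi' - DG L X xi.
      by rewrite -!DGE /DG linearB.
    by rewrite [RHS]addrA subrK.
  apply: le_trans (fnormD _ _) _; rewrite mulrDl; apply: lerD.
    apply: le_trans (G_taylor L hXB _) _; first lra.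
    rewrite -/K2 (mulrC 4) -mulrA (ler_wpM2l (ltW K20)) //.
    have -> : 4 * x ^+ 2 = (2 * x) ^+ 2 by ring.
    by rewrite lerXn2r ?nnegrE ?mnorm_ge0 // mulr_ge0.
  apply: le_trans (fnorm_dG L _ hXB) _; rewrite -/K1 ler_wpM2l //.
  by rewrite exi.
have hXb : mnorm Xbar <= B by rewrite lerDl.
have := G_taylor L hXb hX; have := fnorm_dG L (X - Xbar) hXb.
rewrite [Xbar + (X - Xbar)]addrC subrK -/K1 -/K2; set d := dG _ _ _; set x := mnorm _.
have x0 : 0 <= x by apply: mnorm_ge0.
move=> h1 h2; rewrite -[G L X - _](subrK d); apply: le_trans (fnormD _ _) _.
have : K2 * x ^+ 2 <= K2 * x by rewrite (ler_wpM2l (ltW K20)) // expr2 ler_piMr.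
have : 0 <= K2 * x by rewrite mulr_ge0 // ltW.
lra.
Qed.

Lemma mnorm_retraction_sub X xi : orthogonal_mx X.1.2 -> tangent L X xi ->
  mnorm (retraction X xi - X) <= mnorm xi + mnorm xi ^+ 2.
Proof.
move=> hQ ht; have := mnorm_retraction hQ ht => h.
have -> : retraction X xi - X = xi + (retraction X xi - (X + xi)).
  by rewrite opprD [RHS]addrC addrA subrK.
by apply: le_trans (mnormD _ _) _; rewrite lerD2l.
Qed.

End Local.

(** * One step of the method *)


Section NewtonStep.
Variables (R : realType) (n : nat) (L : 'M[R]_n).
Implicit Types X dX xi : ambient R n.

Definition sufficient_decrease (t : R) X dX (eta : R) : Prop :=
  fnorm (G L (retraction X dX)) <= (1 - t * (1 - eta)) * fnorm (G L X).

(** All rounds are summed up in the product [tau] of their factors. If every fraction up to [tau0]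
    is acceptable, the last rejected one exceeds [tau0], and a single shrinking loses at most the
    factor [theta_min]. *)
Lemma backtrackP (t theta_min theta_max : R) X dX eta dX' eta' :
  0 < theta_min -> theta_min < theta_max -> theta_max < 1 ->
  backtrack L t theta_min theta_max X dX eta dX' eta' ->
  exists tau, [/\ 0 < tau <= 1, dX' = tau *: dX, eta' = 1 - tau * (1 - eta),
    sufficient_decrease t X dX' eta' &
    (sufficient_decrease t X dX eta -> tau = 1) /\
    forall tau0, 0 < tau0 <= 1 ->
      (forall s, 0 < s <= tau0 ->
         sufficient_decrease t X (s *: dX) (1 - s * (1 - eta))) ->
      theta_min * tau0 <= tau].
Proof.
move=> hmin hmm hmax; elim=> {dX eta dX' eta'} [dX eta acc|dX eta th dX' eta' rej hth _].
  exists 1; split=> //; rewrite ?scale1r ?ltr01 ?lexx //.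
    by rewrite mul1r opprB addrC subrK.
  split=> // tau0 /andP[t0 t1] _; rewrite mulr_ile1 // ltW //.
  exact: lt_trans hmax.
move=> [tau [/andP[tau0 tau1] eX ee acc [full low]]].
have /andP[hth1 hth2] := hth.
have th0 : 0 < th by apply: lt_le_trans hth1.
have th1 : th < 1 by apply: le_lt_trans hmax.
exists (tau * th); split=> //.
- by rewrite mulr_gt0 //= mulr_ile1 // ltW.
- by rewrite eX scalerA.
- by rewrite ee; ring.
split=> [h|s0 /andP[s00 s01] h]; first by case: rej.
(* If [th <= s0], the shrunken step is acceptable and the search stops there; otherwise the
   threshold relative to the shrunken step is [s0 / th]. *)
have [le|lt] := leP th s0.
  rewrite full ?mul1r; last by apply: h; rewrite th0.
  by apply: le_trans hth1; rewrite ler_piMr // ltW.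
have -> : theta_min * s0 = theta_min * (s0 / th) * th by field; rewrite gt_eqF.
rewrite ler_pM2r //; apply: low.
  by rewrite divr_gt0 //= ler_pdivrMr // mul1r ltW.
move=> s /andP[sp sle].
have := h (s * th); rewrite mulr_gt0 //= -ler_pdivlMr // => /(_ sle).
by rewrite scalerA; congr (sufficient_decrease _ _ _ _); ring.
Qed.

(** Valid far from [Xbar] too: condition (b) gives [e <= etahat_max < 1], so the accepted factor
    [1 - t * tau * (1 - e)] is below [1]. *)
Lemma newton_cg_decrease (sigma_max eta_max etahat_max t theta_min theta_max : R) X Xn :
  etahat_max < 1 -> 0 < t -> 0 < theta_min -> theta_min < theta_max -> theta_max < 1 ->
  newton_cg_step L sigma_max eta_max etahat_max t theta_min theta_max X Xn ->
  fnorm (G L Xn) <= fnorm (G L X).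
Proof.
move=> h1 ht hmin hmm hmax [G0 [dZ [_ _ hb [dX [eta' [hbt ->]]]]]].
have [tau [/andP[tau0 tau1] eX ee acc _]] := backtrackP hmin hmm hmax hbt.
have g0 := fnorm_gt0 G0.
apply: le_trans acc _; rewrite ler_piMl ?fnorm_ge0 // ee.
set e := _ / _; have he : e <= etahat_max by rewrite ler_pdivrMr.
have : 0 < t * (tau * (1 - e)) by rewrite !mulr_gt0 // subr_gt0 (le_lt_trans he).
lra.
Qed.

Lemma newton_cg_local (sigma_max eta_max etahat_max t theta_min theta_max kappa K : R) :
  0 <= sigma_max < 1 -> 0 <= eta_max < 1 -> 0 <= etahat_max < 1 -> 0 < t < 1 ->
  0 < theta_min -> theta_min < theta_max -> theta_max < 1 ->
  0 < kappa -> 0 < K ->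
  exists c, 0 < c /\ forall X Xn,
    manifold L X ->
    (forall Z, fnorm Z <= kappa * mnorm (DGadj L X Z)) ->
    (forall xi, tangent L X xi -> mnorm xi <= 2^-1 ->
      fnorm (G L (retraction X xi) - G L X - DG L X xi) <= K * mnorm xi ^+ 2) ->
    newton_cg_step L sigma_max eta_max etahat_max t theta_min theta_max X Xn ->
    [/\ exists xi, [/\ tangent L X xi, Xn = retraction X xi
                     & mnorm xi <= c * fnorm (G L X)],
        forall g0, 0 < g0 -> fnorm (G L X) <= g0 ->
          fnorm (G L Xn) <=
            (1 - t * (1 - etahat_max) * (theta_min / (1 + c * g0))) * fnorm (G L X)
      & c * fnorm (G L X) <= 1 -> fnorm (G L Xn) <= c * fnorm (G L X) ^+ 2].
Proof.
move=> /andP[s0 s1] /andP[e0 e1] /andP[h0 h1] /andP[t0 t1] hmin hmm hmax k0 K0.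
set q := 1 - etahat_max; have q0 : 0 < q by rewrite subr_gt0.
have t1' : 0 < 1 - t by rewrite subr_gt0.
(* Chosen so that the Taylor error [K (2 s kappa g)^2] at fraction [s] equals [s c1 g] times
   [s g (1 - t) q]. Once [s c1 g <= 1] it fits into the slack between the linear prediction and the
   required decrease. *)
pose c1 := 4 * K * kappa ^+ 2 / ((1 - t) * q).
have c10 : 0 < c1 by rewrite divr_gt0 ?mulr_gt0.
(* [4 kappa] keeps steps below [1/2]. The bracket is the quadratic rate: [1] from [eta <= g],
   [2 kappa^2] from [sigma |dZ|] with [sigma <= g], and [4 K kappa^2] from the Taylor error. *)
pose c := 4 * kappa + c1 + (1 + 2 * kappa ^+ 2 + 4 * K * kappa ^+ 2).
have kk0 : 0 <= kappa ^+ 2 by apply: sqr_ge0.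
have Kk0 : 0 <= K * kappa ^+ 2 by rewrite mulr_ge0 // ltW.
have c0 : 0 < c by rewrite /c; lra.
exists c; split=> // X Xn hM hlow htay [G0 [dZ [_ ha hb [dX [eta' [hbt eXn]]]]]].
have [tau [/andP[tau0 tau1] eX ee acc [full low]]] := backtrackP hmin hmm hmax hbt.
set g := fnorm (G L X) in ha hb *; have g0 : 0 < g by apply: fnorm_gt0.
set dXh := DGadj L X dZ in ha hb full low eX hbt *.
have [htan hadj] := DGadjP L dZ hM.1; rewrite -/dXh in htan hadj.
set x := mnorm dXh; have x0 : 0 <= x by apply: mnorm_ge0.
have hZ : fnorm dZ <= kappa * x by apply: hlow.
have hH : fnorm (DG L X dXh) <= 2 * g.
  rewrite -[DG L X dXh](addrK (G L X)); apply: le_trans (fnormB _ _) _.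
  apply: le_trans (lerD hb (lexx _)) _; rewrite -/g.
  have : etahat_max * g <= 1 * g by rewrite ler_pM2r // ltW.
  lra.
(* By adjointness [x^2 = frob (DG dXh) dZ <= 2 g * kappa x]. *)
have hx : x <= 2 * kappa * g.
  have : x ^+ 2 <= 2 * g * (kappa * x).
    rewrite mnorm_sqr -hadj //; apply: le_trans (ler_norm _) _.
    by apply: le_trans (ler_frob_fnorm _ _) _; rewrite ler_pM ?fnorm_ge0.
  have [->|xn] := eqVneq x 0; first by rewrite !mulr_ge0 // ltW.
  have xp : 0 < x by rewrite lt_neqAle eq_sym xn.
  by rewrite expr2 mulrA ler_pM2r // => h; lra.
set e := _ / _ in full low ee hbt; have he : e <= etahat_max by rewrite ler_pdivrMr.
have eg : e * g = fnorm (DG L X dXh + G L X) by rewrite divfK // gt_eqF.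
have eq1 : q <= 1 - e by rewrite lerD2l lerN2.
(* the linear model predicts the residual (1 - s (1 - e)) g *)
have model s : 0 < s <= 1 -> s * c * g <= 1 ->
    sufficient_decrease t X (s *: dXh) (1 - s * (1 - e)).
  move=> /andP[sp sle] hs; rewrite /sufficient_decrease -/g.
  have hs1 : s * (4 * kappa + c1) * g <= 1.
    apply: le_trans hs; rewrite ler_pM2r // ler_pM2l // /c; lra.
  have sx : mnorm (s *: dXh) <= s * (2 * kappa * g).
    by rewrite mnormZ gtr0_norm // ler_pM2l.
  have p1 : 0 <= s * c1 * g by exact: mulr_ge0 (mulr_ge0 (ltW sp) (ltW c10)) (ltW g0).
  have p2 : 0 <= s * kappa * g by exact: mulr_ge0 (mulr_ge0 (ltW sp) (ltW k0)) (ltW g0).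
  have hsm : mnorm (s *: dXh) <= 2^-1 by apply: le_trans sx _; nra.
  have ht := htay _ (tangentZ s htan) hsm.
  have hlin : fnorm (G L X + DG L X (s *: dXh)) <= (1 - s * (1 - e)) * g.
    have -> : G L X + DG L X (s *: dXh) =
        (1 - s) *: G L X + s *: (DG L X dXh + G L X).
      have -> : DG L X (s *: dXh) = s *: DG L X dXh by rewrite /DG linearZ.
      by apply/matrixP => i j; rewrite !mxE; ring.
    apply: le_trans (fnormD _ _) _; rewrite !fnormZ -eg -/g.
    by rewrite (ger0_norm (ltW sp)) ger0_norm ?subr_ge0 //; lra.
  have -> : G L (retraction X (s *: dXh)) =
      (G L (retraction X (s *: dXh)) - G L X - DG L X (s *: dXh)) +
      (G L X + DG L X (s *: dXh)) by rewrite -[_ - _ - _]addrA -opprD subrK.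
  apply: le_trans (fnormD _ _) _; apply: le_trans (lerD ht hlin) _.
  have hq : K * mnorm (s *: dXh) ^+ 2 <= K * (s * (2 * kappa * g)) ^+ 2.
    rewrite ler_pM2l // lerXn2r ?nnegrE ?mnorm_ge0 //.
    by apply: le_trans sx; apply: mnorm_ge0.
  have ec : K * (s * (2 * kappa * g)) ^+ 2 = (s * c1 * g) * (s * g * ((1 - t) * q)).
    by rewrite /c1; field; rewrite !gt_eqF.
  have hc : (s * c1 * g) * (s * g * ((1 - t) * q)) <= s * g * ((1 - t) * q).
    have hw : 0 < s * g * ((1 - t) * q) by rewrite !mulr_gt0.
    by rewrite (ler_piMl (ltW hw)) //; lra.
  have hq2 : s * g * ((1 - t) * q) <= s * g * ((1 - t) * (1 - e)).
    by rewrite ler_pM2l ?mulr_gt0 // ler_pM2l.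
  rewrite -ec in hc; lra.
have tanX : tangent L X dX by rewrite eX; apply: tangentZ.
split.
- exists dX; split=> //; rewrite eX mnormZ gtr0_norm //.
  apply: (@le_trans _ _ (1 * x)); first by rewrite ler_wpM2r.
  rewrite mul1r; apply: le_trans hx _; rewrite ler_pM2r // /c; lra.
- move=> b b0 gb; have cb : 0 < c * b by rewrite mulr_gt0.
  have cb1 : 0 < 1 + c * b by rewrite addr_gt0.
  (* [1 / (1 + c b)] lies in []0, 1]], and each positive [s] up to it satisfies [s c g <= 1], so
     [model] accepts it. *)
  have hlow' : theta_min * (1 + c * b)^-1 <= tau.
    apply: low; first by rewrite invr_gt0 cb1 invf_le1 // lerDl ltW.
    move=> s /andP[sp sle]; have hs : s * (1 + c * b) <= 1.
      by rewrite -ler_pdivlMr // div1r.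
    have sc : 0 < s * (c * b) by rewrite mulr_gt0.
    apply: model; first by rewrite sp /=; lra.
    apply: le_trans hs; rewrite -mulrA ler_pM2l // ler_wpDl // ler_pM2l //.
  rewrite eXn; apply: le_trans acc _; rewrite -/g ler_pM2r // ee.
  rewrite lerD2l lerN2 opprB [_ - 1]addrC addrA subrr add0r ?opprK.
  rewrite -mulrA ler_pM2l // mulrC.
  by apply: ler_pM => //; rewrite ?ltW // divr_gt0.
- move=> cg; have hfull : sufficient_decrease t X dXh e.
    have := model 1; rewrite scale1r !mul1r opprB addrC subrK; apply=> //.
    by rewrite ltr01 lexx.
  have eX1 : dX = dXh by rewrite eX full // scale1r.
  rewrite eXn eX1.
  have hx2 : x <= 2^-1.
    apply: le_trans hx _; have : 4 * kappa * g <= c * g by rewrite ler_pM2r // /c; lra.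
    by lra.
  have ht := htay _ htan hx2.
  have hres : fnorm (G L X + DG L X dXh) <= g ^+ 2 + g * (2 * kappa ^+ 2 * g).
    set sg := Num.min sigma_max g in ha.
    have sg0 : 0 <= sg by rewrite le_min s0 ltW.
    have sgg : sg <= g by rewrite ge_min lexx orbT.
    have -> : G L X + DG L X dXh = (DG L X dXh + sg *: dZ + G L X) - sg *: dZ.
      by rewrite [X in _ = X - _]addrAC addrK addrC.
    apply: le_trans (fnormB _ _) _; apply: lerD.
      apply: le_trans ha _; rewrite expr2 ler_pM2r //.
      by rewrite ge_min lexx orbT.
    rewrite fnormZ ger0_norm //; apply: ler_pM => //; first exact: fnorm_ge0.
    apply: le_trans hZ _; have -> : 2 * kappa ^+ 2 * g = kappa * (2 * kappa * g) by ring.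
    by rewrite ler_pM2l.
  have -> : G L (retraction X dXh) =
      (G L (retraction X dXh) - G L X - DG L X dXh) + (G L X + DG L X dXh).
    by rewrite -[_ - _ - _]addrA -opprD subrK.
  apply: le_trans (fnormD _ _) _; apply: le_trans (lerD ht hres) _.
  have hq : K * x ^+ 2 <= K * (2 * kappa * g) ^+ 2.
    by rewrite ler_pM2l // lerXn2r ?nnegrE // (le_trans x0).
  have c2 : (1 + 2 * kappa ^+ 2 + 4 * K * kappa ^+ 2) * g ^+ 2 <= c * g ^+ 2.
    by rewrite ler_pM2r ?exprn_gt0 // /c; lra.
  rewrite -/x; lra.
Qed.

End NewtonStep.

(** * Convergence in the ambient norm *)


Lemma nonincreasing_le (R : realType) (g : nat -> R) :
  (forall k, g k.+1 <= g k) -> forall k m, (k <= m)%N -> g m <= g k.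
Proof.
move=> h k m /subnK <-; elim: (m - k)%N => [//|j IH].
by rewrite addSn; apply: le_trans (h _) IH.
Qed.

(** The indices in [P] may be sparse, but between them [g] does not grow: after [m] visits [g] is at
    most [rho^m * g 0], and it stays so. *)
Lemma frequent_contraction_to0 (R : realType) (g : nat -> R) (P : nat -> Prop) (rho : R) :
  0 <= rho < 1 -> (forall k, 0 <= g k) -> (forall k, g k.+1 <= g k) ->
  (forall N, exists2 k, (N <= k)%N & P k) ->
  (forall k, P k -> g k.+1 <= rho * g k) ->
  forall e, 0 < e -> exists N, forall k, (N <= k)%N -> g k <= e.
Proof.
move=> /andP[r0 r1] g0 gd hP hg e e0.
have pow m : exists k, g k <= rho ^+ m * g 0%N.
  elim: m => [|m [k hk]]; first by exists 0%N; rewrite expr0 mul1r.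
  have [k' kk' Pk'] := hP k; exists k'.+1; apply: le_trans (hg _ Pk') _.
  rewrite exprS -mulrA ler_wpM2l //; apply: le_trans hk.
  exact: nonincreasing_le.
have : rho ^+ m @[m --> \oo] --> (0 : R) by apply: cvg_expr; rewrite ger0_norm.
move=> /cvgrPdist_le /(_ (e / (g 0%N + 1))).
rewrite divr_gt0 ?ltr_wpDl // => /(_ isT) [N _ /(_ N (leqnn N))] /=.
rewrite sub0r normrN ger0_norm ?exprn_ge0 // ler_pdivlMr ?ltr_wpDl // => hN.
have [k hk] := pow N; exists k => m km; apply: le_trans (nonincreasing_le gd km) _.
apply: le_trans hk _; apply: le_trans hN; rewrite ler_wpM2l ?exprn_ge0 //.
by rewrite lerDl.
Qed.

(* The potential [mnorm (X k - Xbar) + 4 c g k] does not increase, which keeps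
   the tail of the sequence in the ball where the quadratic estimate holds. *)
Lemma cluster_quadratic (R : realType) (n : nat) (X : nat -> ambient R n)
    (Xbar : ambient R n) (g : nat -> R) (r c K : R) :
  0 < r -> 0 < c -> 0 < K -> (forall k, 0 <= g k) ->
  (forall e, 0 < e -> exists N, forall k, (N <= k)%N -> g k <= e) ->
  (forall k, mnorm (X k - Xbar) <= r -> c * g k <= 1 ->
     g k.+1 <= c * g k ^+ 2 /\ mnorm (X k.+1 - X k) <= 2 * c * g k) ->
  (forall k, mnorm (X k - Xbar) <= r -> g k <= K * mnorm (X k - Xbar)) ->
  (forall e N, 0 < e -> exists2 k, (N <= k)%N & mnorm (X k - Xbar) <= e) ->
  (forall e, 0 < e -> exists N, forall k, (N <= k)%N -> mnorm (X k - Xbar) <= e) /\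
  exists2 c', 0 < c' & exists N, forall k, (N <= k)%N ->
    mnorm (X k.+1 - Xbar) <= c' * mnorm (X k - Xbar) ^+ 2.
Proof.
move=> r0 c0 K0 g0 gto0 hstep hlip hcl.
(* With [g <= r / (8 c)] the term [4 c g] of the potential is at most [r / 2]; the starting distance
   supplies the other half of [r]. *)
have [N1 hN1] := gto0 (r / (8 * c)) (divr_gt0 r0 (mulr_gt0 (ltr0n _ 8) c0)).
have [N2 hN2] : exists N, forall k, (N <= k)%N -> g k <= (2 * c)^-1.
  by apply: gto0; rewrite invr_gt0 mulr_gt0.
have [k0 hk0 hk0r] := hcl (r / 2) (maxn N1 N2) (divr_gt0 r0 (ltr0n _ 2)).
have cg k : (k0 <= k)%N -> c * g k <= 2^-1.
  move=> kk; have h : g k <= (2 * c)^-1.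
    by apply: hN2; rewrite (leq_trans _ kk) // (leq_trans _ hk0) // leq_maxr.
  rewrite -(ler_pM2l c0) in h; apply: le_trans h _.
  by rewrite le_eqVlt; apply/orP; left; apply/eqP; field; rewrite gt_eqF.
have pot k : (k0 <= k)%N -> mnorm (X k - Xbar) <= r ->
    g k.+1 <= g k / 2 /\ mnorm (X k.+1 - X k) <= 2 * c * g k.
  move=> kk kr; have h := cg k kk; have [|h1 h2] := hstep k kr; first lra.
  split=> //; apply: le_trans h1 _; rewrite expr2 mulrA mulrC.
  by rewrite ler_wpM2l.
have tri k a : mnorm (X k.+1 - a) <= mnorm (X k.+1 - X k) + mnorm (X k - a).
  by apply: le_trans (mnormD _ _); rewrite addrA subrK.
have stay j : mnorm (X (k0 + j)%N - Xbar) + 4 * c * g (k0 + j)%N <= r.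
  elim: j => [|j IH].
    rewrite addn0; have : g k0 <= r / (8 * c).
      by apply: hN1; rewrite (leq_trans _ hk0) // leq_maxl.
    rewrite -(ler_pM2l c0) => h.
    have e : c * (r / (8 * c)) = r / 8 by field; rewrite gt_eqF.
    rewrite e in h; lra.
  rewrite addnS; have cg0 : 0 <= c * g (k0 + j)%N by rewrite mulr_ge0 // ltW.
  have [|h1 h2] := pot _ (leq_addr j k0); first lra.
  rewrite -(ler_pM2l c0) in h1.
  by have := tri (k0 + j)%N Xbar; move: h1 h2 IH cg0; clear => *; lra.
have near k : (k0 <= k)%N -> mnorm (X k - Xbar) <= r.
  move=> /subnKC <-; apply: le_trans (stay (k - k0)%N); rewrite lerDl.
  by rewrite !mulr_ge0 // ltW.
(* The same potential argument centred at [X k]. The weight [4 c] is the geometric sum of the step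
   bounds [2 c g], as [g] at least halves each time. *)
have cauchy k j : (k0 <= k)%N ->
    mnorm (X (k + j)%N - X k) + 4 * c * g (k + j)%N <= 4 * c * g k.
  move=> kk; elim: j => [|j IH]; first by rewrite addn0 subrr mnorm0 add0r.
  rewrite addnS; have kk' : (k0 <= k + j)%N by rewrite (leq_trans kk) // leq_addr.
  have [h1 h2] := pot _ kk' (near _ kk').
  rewrite -(ler_pM2l c0) in h1.
  by have := tri (k + j)%N (X k); move: h1 h2 IH; clear => *; lra.
(* Late iterates come arbitrarily close to [Xbar], so the bound on [|X m - X k|] passes to
   [|X k - Xbar|]. *)
have bound k : (k0 <= k)%N -> mnorm (X k - Xbar) <= 4 * c * g k.
  move=> kk; apply/ler_addgt0Pl => e e0.
  have [m km hm] := hcl e k e0.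
  have := cauchy k (m - k)%N kk; rewrite subnKC // => h.
  have : mnorm (X k - Xbar) <= mnorm (X m - X k) + mnorm (X m - Xbar).
    rewrite (mnorm_distC (X m) (X k)); apply: le_trans (mnormD _ _).
    by rewrite addrA subrK.
  have : 0 <= 4 * c * g m by rewrite !mulr_ge0 // ltW.
  by move: h hm; clear => *; lra.
split.
  move=> e e0; have [N hN] : exists N, forall k, (N <= k)%N -> g k <= e / (4 * c).
    by apply: gto0; rewrite divr_gt0 // mulr_gt0.
  exists (maxn k0 N) => k; rewrite geq_max => /andP[kk kN].
  apply: le_trans (bound k kk) _; rewrite mulrC -ler_pdivlMr ?mulr_gt0 //.
  exact: hN.
(* From [|X k.+1 - Xbar| <= 4 c g k.+1], then [g k.+1 <= c (g k)^2], then
   [g k <= K |X k - Xbar|]. *)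
exists (4 * c * c * K ^+ 2); first by rewrite !mulr_gt0 // exprn_gt0.
exists k0 => k kk; have kr := near k kk.
apply: le_trans (bound k.+1 (leqW kk)) _.
have [|h1 _] := hstep k kr; first by have := cg k kk; lra.
have : g k ^+ 2 <= (K * mnorm (X k - Xbar)) ^+ 2.
  by rewrite lerXn2r ?nnegrE ?hlip // mulr_ge0 ?mnorm_ge0 // ltW.
rewrite exprMn -!mulrA => h2; rewrite !ler_pM2l //; apply: le_trans h1 _.
by rewrite ler_pM2l.
Qed.

Lemma newton_cg_quadratic (R : realType) (n : nat) (L : 'M[R]_n)
    (sigma_max eta_max etahat_max t theta_min theta_max : R)
    (X : nat -> ambient R n) (Xbar : ambient R n) :
  0 <= sigma_max < 1 -> 0 <= eta_max < 1 -> 0 <= etahat_max < 1 -> 0 < t < 1 ->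
  0 < theta_min -> theta_min < theta_max -> theta_max < 1 ->
  (forall k, manifold L (X k)) ->
  (forall k, newton_cg_step L sigma_max eta_max etahat_max t theta_min theta_max
               (X k) (X k.+1)) ->
  manifold L Xbar ->
  set_surj (tangent L Xbar) [set: 'M[R]_n] (DG L Xbar) ->
  (forall e N, 0 < e -> exists2 k, (N <= k)%N & mnorm (X k - Xbar) <= e) ->
  (forall e, 0 < e -> exists N, forall k, (N <= k)%N -> mnorm (X k - Xbar) <= e) /\
  exists2 c, 0 < c & exists N, forall k, (N <= k)%N ->
    mnorm (X k.+1 - Xbar) <= c * mnorm (X k - Xbar) ^+ 2.
Proof.
move=> hs he hh ht hmin hmm hmax hX hgen hM hsurj hcl.
have /andP[t0 t1] := ht; have /andP[h0 h1] := hh.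
have [r1 [kappa [r10 kappa0 hlow]]] := adjoint_bounded_below hM hsurj.
have [K K0 [htay hlip]] := retraction_bounds L hM.1.
have [c [c0 hloc]] := newton_cg_local L hs he hh ht hmin hmm hmax kappa0 K0.
pose r := Num.min r1 1; have r0 : 0 < r by rewrite lt_min r10 ltr01.
have rr1 : r <= r1 by rewrite ge_min lexx.
have r11 : r <= 1 by rewrite ge_min lexx orbT.
have {hloc} loc k (hk : mnorm (X k - Xbar) <= r) := hloc _ _ (hX k)
  (hlow _ (hX k) (le_trans hk rr1)) (fun xi => htay _ xi (hX k) (le_trans hk r11))
  (hgen k).
pose g k := fnorm (G L (X k)).
have g0 k : 0 <= g k by apply: fnorm_ge0.
have gd k : g k.+1 <= g k by apply: newton_cg_decrease (hgen k).
have gp : 0 < g 0%N by have [] := hgen 0%N; move=> h _; apply: fnorm_gt0.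
have gto0 : forall e, 0 < e -> exists N, forall k, (N <= k)%N -> g k <= e.
  (* By monotonicity [g 0] bounds every residual, so one factor [1 - a] works at the infinitely many
     iterates that fall in the ball around [Xbar]. *)
  pose a := t * (1 - etahat_max) * (theta_min / (1 + c * g 0%N)).
  have cb : 0 < c * g 0%N by rewrite mulr_gt0.
  have cb1 : 0 < 1 + c * g 0%N by rewrite addr_gt0.
  have u0 : 0 < t * (1 - etahat_max) by rewrite mulr_gt0 ?subr_gt0.
  have u1 : t * (1 - etahat_max) <= 1.
    by rewrite mulr_ile1 ?subr_ge0 ?gerBl //; apply: ltW.
  have v0 : 0 < theta_min / (1 + c * g 0%N) by rewrite divr_gt0.
  have v1 : theta_min / (1 + c * g 0%N) <= 1 by rewrite ler_pdivrMr // mul1r; lra.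
  have a0 : 0 < a by rewrite mulr_gt0.
  have a1 : a <= 1 by apply: mulr_ile1 => //; apply: ltW.
  apply: (@frequent_contraction_to0 _ g (fun k => mnorm (X k - Xbar) <= r) (1 - a)) => //.
  - by rewrite subr_ge0 a1 /= gtrBl.
  - by move=> N; apply: hcl.
  - move=> k hk; have [_ + _] := loc k hk; apply=> //.
    exact: (nonincreasing_le gd).
(* With a zero at [Xbar], Lipschitz continuity bounds [g k] by a multiple of the distance to
   [Xbar]. *)
have Gb0 : G L Xbar = 0.
  apply: fnorm_eq0; apply/eqP; rewrite eq_le fnorm_ge0 andbT.
  apply/ler_addgt0Pl => e e0; rewrite addr0.
  have [N hN] := gto0 (e / 2) (divr_gt0 e0 (ltr0n _ 2)).
  have m0 : 0 < Num.min 1 (e / (2 * K)) by rewrite lt_min ltr01 divr_gt0 // mulr_gt0.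
  have [k kN hk] := hcl _ N m0; rewrite le_min in hk; case/andP: hk => hk1 hk2.
  have h3 := hlip _ hk1; rewrite -(ler_pM2l K0) in hk2.
  have e2 : K * (e / (2 * K)) = e / 2 by field; rewrite gt_eqF.
  rewrite e2 in hk2; have := hN k kN; rewrite /g => h4.
  have -> : G L Xbar = G L (X k) - (G L (X k) - G L Xbar) by rewrite opprB addrC subrK.
  by apply: le_trans (fnormB _ _) _; lra.
apply: (@cluster_quadratic _ _ X Xbar g r c K) => //.
- move=> k hk hg; have [[xi [tx eX hxi]] _ hq] := loc k hk; split; first exact: hq.
  rewrite eX.
  (* The retraction moves [X k] by at most [|xi| + |xi|^2 <= y + y^2 <= 2 y], as [y = c g <= 1];
     hence the [2 c] in the step bound. *)
  have := mnorm_retraction_sub (hX k).1 tx; have x0 := mnorm_ge0 xi.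
  move: hxi hg; rewrite -/(g k); set y := c * g k => hxi hg hR.
  apply: le_trans hR _; rewrite -mulrA -/y; nra.
- by move=> k hk; have := hlip _ (le_trans hk r11); rewrite Gb0 subr0.
Qed.

(** * Length of curves *)


Section CurveLength.
Variables (R : realType) (n : nat).
Implicit Types (g : R -> ambient R n) (v : ambient R n).

Local Notation mu := (@lebesgue_measure R).

Lemma mnorm_continuous : continuous (@mnorm R n).
Proof.
apply: (@lipschitz_continuous _ _ _ _ (3 * n%:R)) => x y.
apply: le_trans (mnorm_normr _).
have h1 : mnorm x <= mnorm (x - y) + mnorm y by rewrite -{1}[x](subrK y) mnormD.
have h2 : mnorm y <= mnorm (x - y) + mnorm x.
  by rewrite mnorm_distC -{1}[y](subrK x) mnormD.
by rewrite ler_norml; apply/andP; split; lra.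
Qed.

Lemma metric_continuous v : continuous (fun x : ambient R n => metric x v).
Proof.
apply: (@lipschitz_continuous _ _ _ _ (mnorm v * (3 * n%:R))) => x y.
rewrite -metricNl -metricDl; apply: le_trans (ler_metric_mnorm _ _) _.
by rewrite mulrC -mulrA ler_wpM2l ?mnorm_ge0 // mnorm_normr.
Qed.

Lemma is_derive_metric g v (t : R) dgt : is_derive t (1 : R) g dgt ->
  is_derive t (1 : R) (fun s => metric (g s) v) (metric dgt v).
Proof.
move=> [dg <-].
have h : (fun h : R => h^-1 *: (metric ((g \o shift t) (h *: 1)) v - metric (g t) v))
    @ 0^' --> metric ('D_1 g t) v.
  have := cvg_comp _ _ dg (@metric_continuous v ('D_1 g t)).
  apply: cvg_trans; apply: near_eq_cvg; apply: nearW => h /=.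
  by rewrite metricZl metricDl metricNl.
by apply: DeriveDef; [apply: cvgP h|apply: cvg_lim h].
Qed.

(** Pairing with a fixed direction [v] reduces the claim to the scalar fundamental theorem of
    calculus and Cauchy-Schwarz, with no vector-valued integral. The interval is open because the
    derivative of [g] is only known inside. *)
Lemma C1_on_length (a b : R) g v : a < b -> C1_on a b g ->
  measurable_fun `]a, b[ (fun t => mnorm (g^`()%classic t)) /\
  ((metric (g b - g a) v)%:E <=
    (mnorm v)%:E * \int[mu]_(t in `]a, b[) (mnorm (g^`()%classic t))%:E)%E.
Proof.
move=> ab [dg [cg cdg hd]].
have cmdg : {within `[a, b], continuous (fun t => mnorm (dg t))}.
  by move=> t; apply: continuous_comp; [exact: cdg|exact: mnorm_continuous].
have eqd : {in `]a, b[, (fun t => mnorm (dg t)) =1 (fun t => mnorm (g^`()%classic t))}.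
  move=> t; rewrite in_itv /= => tab.
  by rewrite derive1E; have [_ ->] := hd t tab.
have mdg : measurable_fun `[a, b] (fun t => mnorm (dg t)).
  exact: subspace_continuous_measurable_fun.
have mdgo : measurable_fun `]a, b[ (fun t => mnorm (dg t)).
  by apply: measurable_funS mdg => //; apply: subset_itv_oo_cc.
split.
  by apply: eq_measurable_fun mdgo => t; rewrite inE => /eqd.
have cf : {within `[a, b], continuous (fun t => metric (g t) v)}.
  by move=> t; apply: (@continuous_comp (subspace `[a, b]) _ _ g (fun x => metric x v));
    [exact: cg|exact: metric_continuous].
have cdf : {within `[a, b], continuous (fun t => metric (dg t) v)}.
  by move=> t; apply: (@continuous_comp (subspace `[a, b]) _ _ dg (fun x => metric x v));
    [exact: cdg|exact: metric_continuous].
have mdf : measurable_fun `[a, b] (fun t => metric (dg t) v).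
  exact: subspace_continuous_measurable_fun.
have ftc : (\int[mu]_(t in `[a, b]) (metric (dg t) v)%:E =
    (metric (g b) v)%:E - (metric (g a) v)%:E)%E.
  apply: (@continuous_FTC2 _ _ (fun t => metric (g t) v)) => //.
    have [_ ca cb] := (continuous_within_itvP _ ab).1 cf; split=> //.
    move=> t; rewrite in_itv /= => tab.
    by have [] := is_derive_metric v (hd t tab).
  move=> t; rewrite in_itv /= => tab; rewrite derive1E.
  by have [_ ->] := is_derive_metric v (hd t tab).
rewrite metricDl metricNl EFinB -ftc.
apply: le_trans (lee_abs _) _.
apply: le_trans (le_abse_integral _ _ _) _ => //; first exact/measurable_EFinP.
apply: (@le_trans _ _ (\int[mu]_(t in `[a, b]) ((mnorm v)%:E * (mnorm (dg t))%:E))%E).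
  apply: ge0_le_integral => //.
  - by apply/measurable_EFinP; apply: measurableT_comp.
  - by apply/measurable_EFinP; apply: measurable_funM.
  - by move=> t _; rewrite -EFinM lee_fin mulrC ler_metric_mnorm.
rewrite ge0_integralZl //; last 3 first.
- exact/measurable_EFinP.
- by move=> t _; rewrite lee_fin mnorm_ge0.
- by rewrite lee_fin mnorm_ge0.
rewrite (@integral_itv_bndoo _ a b (fun t => (mnorm (dg t))%:E) true false);
  last by apply/measurable_EFinP; exact: mdgo.
rewrite le_eqVlt; apply/orP; left; apply/eqP; congr (_ * _)%E.
by apply: eq_integral => t; rewrite inE => /eqd ->.
Qed.

(** The directional bounds add up over the pieces; taking [v] to be the chord and dividing by its
    norm gives the claim. *)
Lemma piecewise_C1_length g : piecewise_C1 g ->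
  ((mnorm (g 1 - g 0))%:E <= curve_length g)%E.
Proof.
move=> [s [ps /eqP ls] hC].
have key v : ((metric (g 1 - g 0) v)%:E <= (mnorm v)%:E * curve_length g)%E.
  pose a i := nth 0 (0 :: s) i.
  pose h t := mnorm (g^`()%classic t).
  have h0 t : 0 <= h t by apply: mnorm_ge0.
  have alt i : (i < size s)%N -> a i < a i.+1 by move=> /(pathP 0 ps).
  have a0 i : (i <= size s)%N -> 0 <= a i.
    elim: i => [//|i IH] li; apply: le_trans (IH (ltnW li)) _; exact: ltW (alt i li).
  (* Half-open intervals tile without overlap, start from the empty one at [i = 0], and each exceeds
     the open piece where the derivative is known by a single point. *)
  have step i : (i <= size s)%N -> measurable_fun `[0, a i[ h /\
     ((metric (g (a i) - g 0) v)%:E <=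
       (mnorm v)%:E * \int[mu]_(t in `[0%R, a i[) (h t)%:E)%E.
    elim: i => [_|i IH li].
      rewrite /a /= set_itv_ge ?bnd_simp ?ltxx //; split; first exact: measurable_fun_set0.
      by rewrite subrr integral_set0 mule0 /metric /frob !linear0 !mul0mx !linear0 !addr0.
    have [m1 l1] := IH (ltnW li).
    have [m2 l2] := C1_on_length v (alt i li) (hC i li).
    have e : `[0, a i.+1[%classic = (`[0, a i[ `|` `[a i, a i.+1[)%classic :> set R.
      by apply: itv_bndbnd_setU; rewrite bnd_simp ?a0 ?(ltnW li) // ltW // alt.
    have m2' : measurable_fun `[a i, a i.+1[ h by apply/measurable_fun_itv_obnd_cbndP.
    have mU : measurable_fun (`[0, a i[ `|` `[a i, a i.+1[)%classic h.
      by apply/measurable_funU.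
    rewrite e; split; first exact: mU.
    rewrite ge0_integral_setU //; last 3 first.
    - exact/measurable_EFinP.
    - by move=> t _; rewrite lee_fin.
    - by apply/disj_setPS => t /= []; rewrite !in_itv /= => /andP[_ h1] /andP[h2 _];
        have := lt_le_trans h1 h2; rewrite ltxx.
    rewrite ge0_muleDr ?integral_ge0 //; try by move=> t _; rewrite lee_fin.
    have -> : g (a i.+1) - g 0 = (g (a i) - g 0) + (g (a i.+1) - g (a i)).
      by rewrite [RHS]addrC addrA subrK.
    rewrite metricDl EFinD; apply: leeD; first exact: l1.
    by rewrite integral_itv_bndoo //; apply/measurable_EFinP.
  have [ms ls'] := step (size s) (leqnn _).
  have e1 : a (size s) = 1 by rewrite /a nth_last -[X in last X]/(0:R) /= ls.
  rewrite e1 in ms ls'.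
  by rewrite /curve_length -integral_itv_bndo_bndc //; apply/measurable_EFinP.
have c0 : (0 <= curve_length g)%E by apply: integral_ge0 => t _; rewrite lee_fin mnorm_ge0.
have := key (g 1 - g 0); rewrite -mnorm_sqr; set m := mnorm _.
have [->|m0] := eqVneq m 0; first by [].
have mp : 0 < m by rewrite lt_neqAle eq_sym m0 mnorm_ge0.
by rewrite expr2 EFinM lee_pmul2l // lte_fin.
Qed.

Lemma mnorm_rdist (L : 'M[R]_n) (X Y : ambient R n) :
  ((mnorm (X - Y))%:E <= rdist L X Y)%E.
Proof.
apply: le_ereal_inf_tmp => _ [g [pg _ <- <-] <-].
by rewrite mnorm_distC; apply: piecewise_C1_length.
Qed.

End CurveLength.

(** * The Cayley transform *)


Section Cayley.
Variables (R : realType) (n : nat).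
Implicit Types U W Z : 'M[R]_n.

(** The inverse Cayley transform [W = (U + 1)^-1 (U - 1)]. As [E = U + 1] is within distance [1] of
    [2], it satisfies [|E Z| >= |Z|], which gives invertibility and the bound on [W]. Orthogonality
    of [U] reads [E^T E = E^T + E], which makes [W] skew. *)
Lemma cayley_generator U : orthogonal_mx U -> fnorm (U - 1%:M) <= 1 ->
  exists W, [/\ W^T = - W, fnorm W <= fnorm (U - 1%:M)
              & 2 *: invmx (1%:M - W) - 1%:M = U].
Proof.
move=> hU hD; set D := U - 1%:M in hD *; pose E := U + 1%:M.
have eE : E = 2%:M + D.
  by apply/matrixP => i j; rewrite !mxE; case: (i == j); rewrite ?mulr1n ?mulr0n; ring.
have E2 Z : fnorm Z <= fnorm (E *m Z).
  have : fnorm (2 *: Z) <= fnorm (E *m Z) + fnorm (D *m Z).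
    have -> : 2 *: Z = E *m Z - D *m Z by rewrite eE mulmxDl mul_scalar_mx addrK.
    exact: fnormB.
  rewrite fnormZ ger0_norm // => h.
  have : fnorm (D *m Z) <= 1 * fnorm Z.
    by apply: le_trans (fnormM _ _) _; rewrite ler_wpM2r ?fnorm_ge0.
  lra.
have uE : E \in unitmx.
  apply: injective_unitmx => Z h; apply: fnorm_eq0; apply/eqP.
  by rewrite eq_le fnorm_ge0 andbT -(fnorm0 R n) -h.
pose W := 1%:M - 2 *: invmx E.
have eW : W = invmx E *m D.
  have -> : D = E - 2%:M by rewrite eE addrC addKr.
  by rewrite mulmxBr mulVmx // mul_mx_scalar.
exists W; split.
- have e : invmx E + (invmx E)^T = 1%:M.
    have -> : invmx E + (invmx E)^T = (invmx E)^T *m (E^T *m E) *m invmx E.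
      have -> : E^T *m E = E^T + E.
        rewrite /E [(U + _)^T]linearD /= trmx1 mulmxDl !mulmxDr hU !mulmx1 mul1mx.
        by rewrite [1%:M + _]addrC.
      rewrite mulmxDr mulmxDl trmx_inv mulVmx ?unitmx_tr // mul1mx.
      by rewrite -mulmxA mulmxV // mulmx1.
    rewrite mulmxA trmx_inv mulVmx ?unitmx_tr // mul1mx mulmxV //.
  rewrite /W [(_ - _)^T]linearB /= [(_ *: _)^T]linearZ /= trmx1.
  have -> : (invmx E)^T = 1%:M - invmx E by rewrite -e addrAC subrr add0r.
  by apply/matrixP => i j; rewrite !mxE; ring.
- by rewrite eW; apply: le_trans (E2 _) _; rewrite mulKVmx.
- have -> : 1%:M - W = 2 *: invmx E by rewrite /W opprB addrC subrK.
  have u2 : 2 *: invmx E \in unitmx by rewrite unitmxZ ?unitmx_inv // unitfE.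
  by rewrite invmxZ // invmxK scalerA mulfV // scale1r addrK.
Qed.

(** This is [(1 - t W)^-1 (1 + t W)], rewritten with [t] in a single inverse so that differences in
    [t] reduce to differences of inverses. *)
Definition cayley W (t : R) : 'M[R]_n := 2 *: invmx (1%:M - t *: W) - 1%:M.

Definition dcayley W (t : R) : 'M[R]_n :=
  2 *: (invmx (1%:M - t *: W) *m W *m invmx (1%:M - t *: W)).

Lemma skewZ W (t : R) : W^T = - W -> (t *: W)^T = - (t *: W).
Proof. by move=> hW; rewrite linearZ /= hW scalerN. Qed.

Lemma cayley_orthogonal W t : W^T = - W -> orthogonal_mx (cayley W t).
Proof.
move=> /(skewZ t) hW; rewrite /orthogonal_mx /cayley; move: (t *: W) hW => {}W hW.
set N := invmx _; have u := skew_unitmx hW.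
have uT : 1%:M + W \in unitmx by rewrite -[W]opprK; apply: skew_unitmx (skewN hW).
have e : N^T + N = 2 *: (N^T *m N).
  have -> : 2 *: (N^T *m N) = N^T *m ((1%:M - W) + (1%:M + W)) *m N.
    by rewrite addrACA addNr addr0 mulmxDr mulmx1 mulmxDl scaler_nat mulr2n.
  rewrite mulmxDr mulmxDl -(mulmxA _ (1%:M - W)) mulmxV // mulmx1.
  by rewrite skew_invT // mulVmx // mul1mx.
rewrite [(_ - _)^T]linearB /= [(_ *: _)^T]linearZ /= trmx1 mulmxBl !mulmxBr mulmx1 !mul1mx.
rewrite -scalemxAl -scalemxAr -e.
by apply/matrixP => i j; rewrite !mxE; ring.
Qed.

(** The resolvent identity. Used twice in succession it gives the second-order remainder of
    [cayley], and applied to each of the two inverses in [dcayley] it gives the Lipschitz bound. *)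
Lemma inv_skewB W (t s : R) : W^T = - W ->
  invmx (1%:M - t *: W) - invmx (1%:M - s *: W) =
  (t - s) *: (invmx (1%:M - t *: W) *m W *m invmx (1%:M - s *: W)).
Proof.
move=> hW; have ut := skew_unitmx (skewZ t hW); have us := skew_unitmx (skewZ s hW).
apply: (can_inj (mulKmx ut)); rewrite mulmxBr mulmxV // -scalemxAr !mulmxA mulmxV //.
rewrite mul1mx; apply: (can_inj (mulmxK us)).
rewrite mulmxBl mul1mx mulmxKV // -scalemxAl mulmxKV //.
by apply/matrixP => i j; rewrite !mxE; ring.
Qed.

Lemma fnorm_dcayley W t : W^T = - W -> fnorm (dcayley W t) <= 2 * fnorm W.
Proof.
move=> hW; rewrite /dcayley fnormZ ger0_norm // ler_wpM2l //.
apply: le_trans (fnorm_skew_invr _ (skewZ t hW)) _.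
exact: fnorm_skew_inv (skewZ t hW).
Qed.

Lemma cayley_taylor W t s : W^T = - W ->
  fnorm (cayley W s - cayley W t - (s - t) *: dcayley W t)
    <= 2 * fnorm W ^+ 2 * (s - t) ^+ 2.
Proof.
move=> hW; rewrite /cayley /dcayley.
have := inv_skewB s t hW; set Ns := invmx (_ - s *: _); set Nt := invmx (_ - t *: _).
move=> e; have -> : 2 *: Ns - 1%:M - (2 *: Nt - 1%:M) - (s - t) *: (2 *: (Nt *m W *m Nt)) =
   2 *: ((Ns - Nt) - (s - t) *: (Nt *m W *m Nt)).
  by move: (Nt *m W *m Nt) => A; apply/matrixP => i j; rewrite !mxE; ring.
have -> : Ns - Nt - (s - t) *: (Nt *m W *m Nt) =
    (s - t) ^+ 2 *: (Ns *m (W *m (Nt *m (W *m Nt)))).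
  rewrite e -scalerBr expr2 -scalerA; congr (_ *: _).
  rewrite -!mulmxA -mulmxBl e -scalemxAl; congr (_ *: _).
  by rewrite !mulmxA.
rewrite !fnormZ ger0_norm // ger0_norm ?sqr_ge0 //.
rewrite -mulrA ler_wpM2l // mulrC ler_wpM2r ?sqr_ge0 //.
apply: le_trans (fnorm_skew_inv _ (skewZ s hW)) _.
apply: le_trans (fnormM _ _) _; rewrite expr2 ler_wpM2l ?fnorm_ge0 //.
apply: le_trans (fnorm_skew_inv _ (skewZ t hW)) _.
exact: fnorm_skew_invr (skewZ t hW).
Qed.

Lemma dcayley_lipschitz W t s : W^T = - W ->
  fnorm (dcayley W t - dcayley W s) <= 4 * fnorm W ^+ 2 * `|t - s|.
Proof.
move=> hW; rewrite /dcayley.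
have := inv_skewB t s hW; set Ns := invmx (_ - s *: _); set Nt := invmx (_ - t *: _).
move=> e.
have -> : 2 *: (Nt *m W *m Nt) - 2 *: (Ns *m W *m Ns) =
    (2 * (t - s)) *: (Nt *m (W *m (Ns *m (W *m Nt)))
      + Ns *m (W *m (Nt *m W *m Ns))).
  rewrite -scalerBr -scalerA; congr (_ *: _).
  have -> : Nt *m W *m Nt - Ns *m W *m Ns =
      (Nt - Ns) *m (W *m Nt) + Ns *m (W *m (Nt - Ns)).
    rewrite mulmxBl mulmxBr mulmxBr !mulmxA.
    by rewrite addrA subrK.
  by rewrite e -scalemxAl -!scalemxAr -scalerDr !mulmxA.
have c A : fnorm (W *m A) <= fnorm W * fnorm A by apply: fnormM.
have b1 : fnorm (Nt *m (W *m (Ns *m (W *m Nt)))) <= fnorm W ^+ 2.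
  apply: le_trans (fnorm_skew_inv _ (skewZ t hW)) _.
  apply: le_trans (c _) _; rewrite expr2 ler_wpM2l ?fnorm_ge0 //.
  apply: le_trans (fnorm_skew_inv _ (skewZ s hW)) _.
  exact: fnorm_skew_invr (skewZ t hW).
have b2 : fnorm (Ns *m (W *m (Nt *m W *m Ns))) <= fnorm W ^+ 2.
  apply: le_trans (fnorm_skew_inv _ (skewZ s hW)) _.
  apply: le_trans (c _) _; rewrite expr2 ler_wpM2l ?fnorm_ge0 //.
  apply: le_trans (fnorm_skew_invr _ (skewZ s hW)) _.
  exact: fnorm_skew_inv (skewZ t hW).
rewrite fnormZ normrM ger0_norm //.
have -> : 4 * fnorm W ^+ 2 * `|t - s| =
    2 * `|t - s| * (fnorm W ^+ 2 + fnorm W ^+ 2) by ring.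
rewrite ler_wpM2l ?mulr_ge0 //.
by apply: le_trans (fnormD _ _) _; apply: lerD.
Qed.

End Cayley.


(** * Bounding the Riemannian distance by the ambient norm *)

Section UpperBound.
Variables (R : realType) (n : nat).

Lemma is_derive_quadratic (g : R -> ambient R n) (d : ambient R n) (c t : R) :
  (forall s, mnorm (g s - g t - (s - t) *: d) <= c * (s - t) ^+ 2) ->
  is_derive t (1 : R) g d.
Proof.
move=> hg.
have h : (fun h : R => h^-1 *: ((g \o shift t) (h *: 1) - g t)) @ 0^' --> d.
  apply/cvgrPdist_le => e e0.
  have c0 : 0 < `|c| + 1 by rewrite ltr_wpDl.
  near=> h.
  have hn : h != 0 by near: h; apply: nbhs_dnbhs_neq.
  have he : `|h| <= e / (`|c| + 1) by near: h; apply: dnbhs0_le; rewrite divr_gt0.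
  have -> : d - h^-1 *: ((g \o shift t) (h *: 1) - g t) =
      - (h^-1 *: (g (h + t) - g t - (h + t - t) *: d)).
    by rewrite addrK [in RHS]scalerBr scalerA mulVf // scale1r opprB /= [h *: 1]mulr1.
  rewrite normrN normrZ normfV; apply: (@le_trans _ _ (`|h|^-1 * (c * h ^+ 2))).
    rewrite ler_wpM2l ?invr_ge0 //; apply: le_trans (normr_mnorm _) _.
    by have := hg (h + t); rewrite addrK.
  rewrite ler_pdivlMr // in he; apply: le_trans he.
  rewrite -[h ^+ 2]real_normK ?num_real // expr2 mulrCA mulKf ?normr_eq0 //.
  rewrite mulrC ler_wpM2l // (le_trans (ler_norm _)) // lerDl //.
by apply: DeriveDef; [apply: cvgP h|apply: cvg_lim h].
Unshelve. all: by end_near. Qed.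

(** Affine in the two linear blocks, a Cayley curve in the orthogonal one, so it stays on the
    manifold. It ends at [Y] when [W] generates [X.1.2^T *m Y.1.2]. *)
Definition cayley_curve (X Y : ambient R n) (W : 'M[R]_n) (t : R) : ambient R n :=
  (X.1.1 + t *: (Y.1.1 - X.1.1), X.1.2 *m cayley W t, X.2 + t *: (Y.2 - X.2)).

Definition dcayley_curve (X Y : ambient R n) (W : 'M[R]_n) (t : R) : ambient R n :=
  (Y.1.1 - X.1.1, X.1.2 *m dcayley W t, Y.2 - X.2).

Lemma is_derive_cayley_curve X Y W t : orthogonal_mx X.1.2 -> W^T = - W ->
  is_derive t (1 : R) (cayley_curve X Y W) (dcayley_curve X Y W t).
Proof.
move=> hQ hW; apply: (@is_derive_quadratic _ _ (2 * fnorm W ^+ 2)) => s.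
have -> : cayley_curve X Y W s - cayley_curve X Y W t - (s - t) *: dcayley_curve X Y W t
   = (0, X.1.2 *m (cayley W s - cayley W t - (s - t) *: dcayley W t), 0) :> ambient R n.
  apply: ambient_eq => /=.
  - by apply/matrixP => i j; rewrite !mxE; ring.
  - by rewrite !mulmxBr scalemxAr.
  - by apply/matrixP => i j; rewrite !mxE; ring.
by rewrite mnorm_Q fnorm_orthl //; apply: cayley_taylor.
Qed.

(** The speed of the Cayley curve is at most [m + 2 m + m], one summand per block. Distance at most
    [1] is what [cayley_generator] asks of [X.1.2^T *m Y.1.2]. *)
Lemma rdist_le (L : 'M[R]_n) (X Y : ambient R n) :
  manifold L X -> manifold L Y -> mnorm (X - Y) <= 1 ->
  (rdist L X Y <= (4 * mnorm (X - Y))%:E)%E.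
Proof.
move=> [hQX hVX] [hQY hVY] hXY; rewrite mnorm_distC in hXY *.
have [d1 d2 d3] := fnorm_mnorm (Y - X); set m := mnorm (Y - X) in hXY d1 d2 d3 *.
have hU : orthogonal_mx (X.1.2^T *m Y.1.2).
  rewrite /orthogonal_mx trmx_mul trmxK mulmxA -(mulmxA _ X.1.2).
  by rewrite orthogonal_mxT // mulmx1.
have eU : fnorm (X.1.2^T *m Y.1.2 - 1%:M) <= m.
  have -> : X.1.2^T *m Y.1.2 - 1%:M = X.1.2^T *m (Y - X).1.2 by rewrite mulmxBr hQX.
  by rewrite fnorm_orthl //; apply: orthogonal_trmx.
have [W [hW nW cW]] := cayley_generator hU (le_trans eU hXY).
have {}nW : fnorm W <= m by apply: le_trans eU.
pose g := cayley_curve X Y W.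
have dg t : is_derive t (1 : R) g (dcayley_curve X Y W t).
  exact: is_derive_cayley_curve.
have mdg t : mnorm (dcayley_curve X Y W t) <= 4 * m.
  apply: le_trans (mnorm_le_sum _) _ => /=; rewrite fnorm_orthl //.
  have := fnorm_dcayley t hW; rewrite /= in d1 d3; lra.
have cdg : continuous (dcayley_curve X Y W).
  apply: (@lipschitz_continuous _ _ _ _ (4 * fnorm W ^+ 2)) => t s.
  apply: le_trans (normr_mnorm _) _.
  have -> : dcayley_curve X Y W t - dcayley_curve X Y W s
     = (0, X.1.2 *m (dcayley W t - dcayley W s), 0) :> ambient R n.
    by apply: ambient_eq => /=; rewrite ?subrr // mulmxBr.
  by rewrite mnorm_Q fnorm_orthl //; apply: dcayley_lipschitz.
have g'E : g^`()%classic = dcayley_curve X Y W.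
  by apply/funext => t; rewrite derive1E; have [_ ->] := dg t.
apply: (@le_trans _ _ (curve_length g)).
  apply: ereal_inf_lbound; exists g => //; split.
  - exists [:: 1]; first by apply: itv_partition1.
    case=> // _ /=; exists (dcayley_curve X Y W); split.
    + by apply: derivable_within_continuous => t _; have [] := dg t.
    + exact: continuous_subspaceT.
    + by move=> t _.
  - move=> t _; split=> /=.
      rewrite /orthogonal_mx trmx_mul mulmxA -(mulmxA _ _^T) hQX mulmx1.
      exact: cayley_orthogonal.
    by move=> i j h; rewrite !mxE hVX // hVY // subrr mulr0 addr0.
  - apply: ambient_eq; rewrite /= ?scale0r ?addr0 //.
    rewrite /cayley scale0r subr0 invmx1 -[X in _ *m X]/(2 *: 1%:M - 1%:M).
    by rewrite scaler_nat mulr2n addrK mulmx1.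
  - apply: ambient_eq => /=; rewrite ?scale1r; [|  |by rewrite addrC subrK].
      by rewrite addrC subrK.
    by rewrite /cayley scale1r cW mulmxA orthogonal_mxT // mul1mx.
rewrite /curve_length g'E.
have -> : (4 * m)%:E = (\int[@lebesgue_measure R]_(t in `[0%R, 1%R]) (cst (4 * m)%:E t))%E.
  by rewrite integral_cst //= lebesgue_measure_itv /= lte_fin ltr01 oppr0 adde0 mule1.
apply: ge0_le_integral => //.
- by move=> t _; rewrite lee_fin mnorm_ge0.
- apply/measurable_EFinP; apply: subspace_continuous_measurable_fun => //.
  apply: continuous_subspaceT => t.
  by apply: continuous_comp; [exact: cdg|exact: mnorm_continuous].
- by move=> t _; rewrite lee_fin.
Qed.

End UpperBound.

(** * Quadratic convergence *)


Lemma cluster_mnorm (R : realType) (n : nat) (X : nat -> ambient R n) (Xbar : ambient R n) :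
  cluster (X k @[k --> \oo]) Xbar ->
  forall e N, 0 < e -> exists2 k, (N <= k)%N & mnorm (X k - Xbar) <= e.
Proof.
move=> hcl e N e0.
have d0 : 0 < e / (3 * n%:R + 1) by rewrite divr_gt0 // ltr_wpDl // mulr_ge0.
have hA : (X k @[k --> \oo]) [set X k | k in [set k | (N <= k)%N]].
  by exists N => // k /= Nk; exists k.
have [_ [[k Nk <-] hk]] := hcl _ _ hA (nbhsx_ballx Xbar _ d0).
exists k => //; apply: le_trans (mnorm_normr _) _.
move: hk; rewrite -ball_normE /= distrC => hk.
have := ltW hk; rewrite ler_pdivlMr; last by rewrite ltr_wpDl // mulr_ge0.
by apply: le_trans; rewrite mulrC ler_wpM2l // lerDl.
Qed.

Theorem theorem3p7 (R : realType) (n s : nat) (lam : n.-tuple R[i])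
    (hconj : self_conjugate lam) (hord : pairs_first s lam)
    (sigma_max eta_max etahat_max t theta_min theta_max : R)
    (hsigma : 0 <= sigma_max < 1) (heta : 0 <= eta_max < 1)
    (hetahat : 0 <= etahat_max < 1) (ht : 0 < t < 1)
    (htheta_min : 0 < theta_min) (htheta : theta_min < theta_max)
    (htheta_max : theta_max < 1)
    (X : nat -> ambient R n) (Xbar : ambient R n)
    (hX : forall k : nat, manifold (Lambda s lam) (X k))
    (hgen : generated_by_newton_cg (Lambda s lam) sigma_max eta_max etahat_max
              t theta_min theta_max X)
    (hXbar : manifold (Lambda s lam) Xbar)
    (haccum : cluster (X k @[k --> \oo]) Xbar)
    (hsurj : set_surj (tangent (Lambda s lam) Xbar) [set: 'M[R]_n]
               (DG (Lambda s lam) Xbar)) :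
  converges_quadratically (Lambda s lam) X Xbar.
Proof.
have [hlim [c c0 [N hN]]] := newton_cg_quadratic hsigma heta hetahat ht htheta_min
  htheta htheta_max hX hgen.2 hXbar hsurj (cluster_mnorm haccum).
split.
  apply/cvgrPdist_le => e e0; have [M hM] := hlim e e0.
  exists M => // k /= Mk; rewrite distrC.
  by apply: le_trans (normr_mnorm _) _; apply: hM.
(* From index [M] on, [X k.+1] is within distance [1] of [Xbar], as [rdist_le] requires; its factor
   [4] enters the final constant. *)
have [M hM] := hlim 1 ltr01.
exists (4 * c); first by rewrite mulr_gt0.
exists (maxn N M) => // k /=; rewrite geq_max => /andP[Nk Mk].
apply: le_trans (rdist_le (hX k.+1) hXbar (hM _ (leqW Mk))) _.
have hk := hN k Nk; set m := mnorm (X k - Xbar) in hk.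
apply: (@le_trans _ _ ((4 * c)%:E * m%:E ^+ 2)%E).
  by rewrite -EFin_expe -EFinM lee_fin -mulrA ler_pM2l.
rewrite lee_pmul2l // ?lte_fin ?mulr_gt0 // !expe2.
have hm := mnorm_rdist (Lambda s lam) (X k) Xbar.
by apply: lee_pmul => //; rewrite lee_fin mnorm_ge0.
Qed.
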